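(* Let $0<\alpha\le 1$ and let $\delta,\epsilon,p,q$ be real numbers. Consider the fractional order delay differential equation $$D^\alpha x(t)=\delta x(t-\tau)-\epsilon (x(t-\tau))^3-p(x(t))^2+qx(t)$$ and its equilibrium point $x_2^*=\dfrac{-p+\sqrt{p^2+4\epsilon(\delta+q)}}{2\epsilon}$. If $\epsilon<0$, $p>0$ and $q+\delta<0$, then $x_2^*$ is unstable for all $\tau\ge 0$.
   Context: $D^\alpha$ denotes the Caputo fractional derivative: $D^1x=x'$, and for $0<\alpha<1$, $D^\alpha x(t)=\frac{1}{\Gamma(1-\alpha)}\int_0^t (t-s)^{-\alpha}x'(s)\,ds$. Initial data: $x(t)=\phi(t)$ for $-\tau\le t\le 0$, where $\phi:[-\tau,0]\to\mathbb{R}$; the corresponding solution is denoted $x(t,\phi)$, and $\|\phi\|=\sup_{-\tau\le t\le 0}|\phi(t)|$. (For $\tau=0$ the initial datum is just $x(0)$.) An equilibrium point is a steady state (constant) solution. An equilibrium point $x^*$ is stable if for every $\eta>0$ there is $\rho>0$ such that $\|\phi-x^*\|<\rho$ implies $|x(t,\phi)-x^*|<\eta$ for all $t\ge 0$. It is asymptotically stable if it is stable and there is $b_0>0$ such that $\|\phi-x^*\|<b_0$ implies $\lim_{t\to\infty}x(t,\phi)=x^*$. It is unstable if it is not stable. *)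

(* Defs.v *)
From mathcomp Require Import all_boot all_order all_algebra.
From mathcomp Require Import all_classical all_reals all_analysis.

Set Implicit Arguments.
Unset Strict Implicit.
Unset Printing Implicit Defensive.

Import Order.TTheory GRing.Theory Num.Theory numFieldNormedType.Exports.

Local Open Scope classical_set_scope.
Local Open Scope ring_scope.

Section caputo.
Context {R : realType}.
Local Notation mu := (@lebesgue_measure R).

(* Euler's integral; it converges for z > 0, the only case used. *)
Definition Gamma (z : R) : R :=
  \int[mu]_(u in `]0, +oo[) (u `^ (z - 1) * expR (- u)).

(* Absolute continuity on [a, b], in the form given by the fundamental theorem
   of calculus. In the Caputo integral the derivative can only be asked to
   exist almost everywhere: for alpha < 1, solutions behave like t `^ alpha at
   0 and in general are not differentiable at the multiples of the delay. *)
Definition abs_continuous (a b : R) (x : R -> R) : Prop :=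
  [/\ {ae mu, forall s : R, s \in `]a, b[ -> derivable x s 1},
      mu.-integrable `[a, b] (fun s : R => (derive1 x s)%:E) &
      forall s : R, s \in `[a, b] -> x s = x a + \int[mu]_(r in `[a, s]) derive1 x r].

Definition caputo (alpha : R) (x : R -> R) (t : R) : R :=
  if alpha == 1 then derive1 x t
  else (Gamma (1 - alpha))^-1 *
       \int[mu]_(s in `[0, t]) ((t - s) `^ (- alpha) * derive1 x s).

(* Derivatives and integrals are total functions, hence the need to say when
   [caputo alpha x t] is meaningful. *)
Definition caputo_derivable (alpha : R) (x : R -> R) (t : R) : Prop :=
  if alpha == 1 then derivable x t 1
  else abs_continuous 0 t x /\
       mu.-integrable `[0, t] (fun s : R => ((t - s) `^ (- alpha) * derive1 x s)%:E).

End caputo.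

Section delay_equation.
Context {R : realType}.
Implicit Types (alpha tau T xs : R) (f : R -> R -> R) (phi x : R -> R).

(* x solves  D^alpha x(t) = f (x(t)) (x(t - tau))  on [0, T[  with initial
   datum phi; only the values of phi on [-tau, 0] and of x on [-tau, T[
   matter. *)
Definition is_solution alpha tau f phi T x : Prop :=
  [/\ {within `[- tau, T[, continuous x},
      forall t : R, t \in `[- tau, 0] -> x t = phi t &
      forall t : R, t \in `]0, T[ ->
        caputo_derivable alpha x t /\
        caputo alpha x t = f (x t) (x (t - tau))].

Definition equilibrium alpha tau f xs : Prop :=
  forall T, 0 < T -> is_solution alpha tau f (cst xs) T (cst xs).

Definition history_norm tau phi : R :=
  sup [set `|phi t| | t in `[- tau, 0]].

(* Solutions may blow up in finite time, so the bound is imposed on every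
   solution, on whatever interval [0, T[ it is defined. Hence the failure of
   stability is witnessed by actual solutions moving away from xs, and never
   by an initial datum that has no (global) solution. *)
Definition stable alpha tau f xs : Prop :=
  forall eta : R, 0 < eta -> exists2 rho : R, 0 < rho &
    forall phi, {within `[- tau, 0], continuous phi} ->
      history_norm tau (fun t => phi t - xs) < rho ->
      forall T x, 0 < T -> is_solution alpha tau f phi T x ->
        forall t : R, t \in `[0, T[ -> `|x t - xs| < eta.

Definition unstable alpha tau f xs : Prop := ~ stable alpha tau f xs.

End delay_equation.

(* u stands for x(t) and v for the delayed value x(t - tau). *)
Definition rhs {R : realType} (delta eps p q : R) (u v : R) : R :=
  delta * v - eps * v ^+ 3 - p * u ^+ 2 + q * u.

Definition x2star {R : realType} (delta eps p q : R) : R :=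
  (- p + Num.sqrt (p ^+ 2 + 4 * eps * (delta + q))) / (2 * eps).

(* Main.v *)
Require Import Defs.
From mathcomp Require Import all_boot all_order all_algebra.
From mathcomp Require Import all_classical all_reals all_analysis.
From mathcomp Require Import measurable_realfun ring lra.

(** Let y = x - x*, where x* < 0 is the equilibrium. The equation becomes
    D^alpha y (t) = g (y t) (y (t - tau)) with
    g u v = a u + b v - p u^2 + 3 e x* v^2 + e v^3 and e = - eps > 0.
    Two features of g give the result. First, a + b = - x* sqrt D > 0, where D is the
    discriminant of the equilibrium equation, so that for every delay the
    characteristic equation lam^alpha = a + b e^(-lam tau) has a root lam > 0
    ([char_root]). Second, g u v <= a u + b v when |v| <= |x*|, because p > 0, e > 0 and
    x* < 0: near the equilibrium the nonlinear terms push downwards.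

    Start from the constant history - c, with c > 0 small, and suppose that the
    solution stays in a small neighbourhood of 0 for ever. Then Z = y + c is the
    convolution of t^(alpha - 1) / Gamma alpha with g (y, y_tau). In the Laplace
    transform at lam the contribution of Z cancels because lam is a characteristic
    root; what remains is c (a + b) / lam on one side and the transform of the
    nonlinear terms, which is nonpositive, on the other side: a contradiction. On a
    finite horizon T the argument holds up to an error e^(-lam T / 2) times a
    constant ([laplace_bound]), so that the trajectory leaves the neighbourhood
    by a time T that is known in advance ([trajectory_escapes]).

    Instability has to be witnessed by a solution, which must therefore be
    constructed on all of [0, T[, as an absolutely continuous function. The unknown
    is its derivative z. Differentiating the Volterra equation,
    z = g (- c) (- c) k + k convolved with (A (y) z + B (y_tau) z_tau), where k is the
    fractional kernel, A and B are the partial derivatives of g, and y is the primitive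
    of z starting from - c. Once A and B are clipped they are bounded and Lipschitz, and
    the right-hand side is a contraction in L1 for a suitable exponential weight
    ([weighted_fixpoint], [delay_map_fixpoint]). The kernels of orders 1 - alpha and
    alpha convolve to 1 ([conv_fkern]); hence convolving the equation with the former
    gives the Caputo equation ([volterra_caputo]), and integrating it gives the
    Volterra equation that is used for the Laplace transform ([volterra_state]). Here
    the chain rule [density_cubic_field] recognizes g (y, y_tau), as long as the clipping
    is not felt. If the equilibrium were stable, a first exit argument ([bootstrap])
    would show that it is never felt, so that the trajectory would be a solution that
    stays close to the equilibrium up to time T. *)

Import Order.TTheory GRing.Theory Num.Theory numFieldNormedType.Exports.

Local Open Scope ring_scope.
Local Open Scope classical_set_scope.
Set Implicit Arguments.
Unset Strict Implicit.
Unset Printing Implicit Defensive.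

(** * Affine changes of variables *)

Section affine.
Context {R : realType}.
Local Notation mu := (@lebesgue_measure R).
Implicit Types a b : R.

Lemma measurable_affine a b : measurable_fun [set: R] (fun x : R => a * x + b).
Proof. by apply: measurable_funD => //; apply: measurable_funM. Qed.

(** Scaling is needed for the homogeneity of the power kernels, translations and
    the reflection for the delay and for commutativity of convolution. *)
Lemma lebesgue_measure_affine a b (A : set R) : a != 0 -> measurable A ->
  mu ((fun x : R => a * x + b) @^-1` A) = (`|a|^-1%:E * mu A)%E.
Proof.
move=> a0 mA.
have a0' : 0 < `|a| by rewrite normr_gt0.
pose phi : measurableTypeR R -> measurableTypeR R := fun x : R => a * x + b.
have mphi : measurable_fun setT phi by exact: measurable_affine.
have [m1 m1E] : exists m1 : {measure set (measurableTypeR R) -> \bar R},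
    forall A, m1 A = (`|a|%:E * mu (phi @^-1` A))%E.
  unshelve eexists (mscale (NngNum (ltW a0')) (pushforward mu phi)) => //.
suff H : forall B, measurable B -> mu B = m1 B.
  by rewrite [mu A](H A mA) m1E muleA -EFinM mulVf ?gt_eqF// mul1e.
(* By uniqueness of Lebesgue measure, half-open intervals are enough. *)
apply: lebesgue_measure_unique => X [[u v] _ <-] /=.
rewrite m1E /phi.
have [a_gt0|a_lt0] : 0 < a \/ a < 0 by move: a0; rewrite neq_lt => /orP[]; [right|left].
- rewrite (_ : _ @^-1` _ = `]((u - b) / a), ((v - b) / a)]%classic).
    rewrite !lebesgue_measure_itv /= !lte_fin ltr_pM2r ?invr_gt0// ltrD2r.
    case: ifPn => // _; last by rewrite mule0.
    by rewrite -!EFinB -EFinM gtr0_norm//; congr EFin; field; rewrite gt_eqF.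
  apply/seteqP; split => x /=; rewrite !in_itv /= ltr_pdivrMr// ler_pdivlMr// [x * a]mulrC; lra.
- rewrite (_ : _ @^-1` _ = `[((v - b) / a), ((u - b) / a)[%classic).
    rewrite !lebesgue_measure_itv /= !lte_fin ltr_nM2r ?invr_lt0// ltrD2r.
    case: ifPn => // _; last by rewrite mule0.
    by rewrite -!EFinB -EFinM ltr0_norm//; congr EFin; field; rewrite lt_eqF.
  apply/seteqP; split => x /=; rewrite !in_itv /= ltr_ndivlMr// ler_ndivrMr// [x * a]mulrC; lra.
Qed.

Lemma ge0_integral_affine a b (f : R -> \bar R) : a != 0 ->
  measurable_fun [set: R] f -> (forall x, 0 <= f x)%E ->
  (\int[mu]_x f (a * x + b)%R = `|a|^-1%:E * \int[mu]_x f x)%E.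
Proof.
move=> a0 mf f0.
have a0' : 0 <= `|a|^-1 by [].
pose phi : measurableTypeR R -> measurableTypeR R := fun x : R => a * x + b.
have mphi : measurable_fun setT phi by exact: measurable_affine.
rewrite -(ge0_integral_mscale mu measurableT (NngNum a0'))//.
rewrite -[LHS](@ge0_integral_pushforward _ _ _ _ R phi mphi mu setT f)//.
apply: eq_measure_integral => A mA _.
exact: lebesgue_measure_affine.
Qed.

Lemma integral_isometry a b (f : R -> \bar R) : `|a| = 1 ->
  measurable_fun [set: R] f ->
  (\int[mu]_x f (a * x + b)%R = \int[mu]_x f x)%E.
Proof.
move=> a1 mf; have a0 : a != 0 by rewrite -normr_eq0 a1 oner_eq0.
rewrite [LHS]integralE [RHS]integralE.
have E g : measurable_fun [set: R] g -> (forall x, 0 <= g x)%E ->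
    (\int[mu]_x g (a * x + b)%R = \int[mu]_x g x)%E.
  by move=> mg g0; rewrite ge0_integral_affine// a1 invr1 mul1e.
rewrite (funepos_comp f (fun x : R => a * x + b)).
rewrite (funeneg_comp f (fun x : R => a * x + b)).
congr (_ - _)%E.
- by apply: E => [|x]; [exact: measurable_funepos|exact: funepos_ge0].
- by apply: E => [|x]; [exact: measurable_funeneg|exact: funeneg_ge0].
Qed.

Lemma integrable_affine a b (f : R -> R) : a != 0 ->
  mu.-integrable setT (EFin \o f) ->
  mu.-integrable setT (EFin \o (fun x => f (a * x + b))).
Proof.
move=> a0 /integrableP[mf fi]; apply/integrableP; split.
  apply: (measurableT_comp mf); exact: measurable_affine.
rewrite (ge0_integral_affine b (f := fun x => `|(EFin \o f) x|%E))//.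
  by rewrite lte_mul_pinfty// lee_fin.
exact: measurableT_comp.
Qed.

Lemma Rintegral_shift b (f : R -> R) : measurable_fun [set: R] f ->
  \int[mu]_x f (x - b) = \int[mu]_x f x.
Proof.
move=> mf; rewrite /Rintegral; congr fine.
have /= <- := @integral_isometry 1 (- b) (EFin \o f) (normr1 _).
  by apply: eq_integral => x _; rewrite mul1r.
exact/measurable_EFinP.
Qed.

Lemma Rintegral_reflect b (f : R -> R) : measurable_fun [set: R] f ->
  \int[mu]_x f (b - x) = \int[mu]_x f x.
Proof.
move=> mf; rewrite /Rintegral; congr fine.
have /= <- := @integral_isometry (-1) b (EFin \o f) (normrN1 _).
  by apply: eq_integral => x _; rewrite mulN1r addrC.
exact/measurable_EFinP.
Qed.

End affine.

(** * Convolution on the line *)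

Section convolution.
Context {R : realType}.
Local Notation mu := (@lebesgue_measure R).
Implicit Types f g h : R -> R.

(** Convolution over the whole line. Causality is encoded in the functions, which
    vanish on the negative half-line, so that no domain has to be carried along. *)
Definition conv f g (t : R) : R := \int[mu]_s (f (t - s) * g s).

Lemma measurable_conv_kernel f g : measurable_fun [set: R] f ->
  measurable_fun [set: R] g ->
  measurable_fun [set: R * R] (fun p : R * R => f (p.1 - p.2) * g p.2).
Proof.
move=> mf mg; apply: measurable_funM.
  apply: (measurableT_comp mf); exact: measurable_funB.
exact: measurableT_comp.
Qed.

Lemma measurable_conv f g : measurable_fun [set: R] f ->
  measurable_fun [set: R] g -> measurable_fun [set: R] (conv f g).
Proof.
move=> mf mg.
have mK : measurable_fun [set: R * R]
    (fun p : R * R => (f (p.1 - p.2) * g p.2)%:E).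
  by apply/measurable_EFinP; apply: (measurable_conv_kernel mf mg).
suff mI : measurable_fun [set: R]
    (fun t => \int[mu]_s (f (t - s) * g s)%:E)%E.
  exact: (measurableT_comp _ mI).
under eq_fun do rewrite integralE.
apply: emeasurable_funB.
- rewrite [X in measurable_fun _ X](_ : _ = fubini_F mu (fun p : R * R => (f (p.1 - p.2) * g p.2)%:E)^\+%E).
    by apply: measurable_fun_fubini_tonelli_F; [exact: measurable_funepos|exact: funepos_ge0].
  by apply/funext => t; apply: eq_integral => s _; rewrite unlock.
- rewrite [X in measurable_fun _ X](_ : _ = fubini_F mu (fun p : R * R => (f (p.1 - p.2) * g p.2)%:E)^\-%E).
    by apply: measurable_fun_fubini_tonelli_F; [exact: measurable_funeneg|exact: funeneg_ge0].
  by apply/funext => t; apply: eq_integral => s _; rewrite unlock.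
Qed.

Lemma integrable_shift b f : mu.-integrable setT (EFin \o f) ->
  mu.-integrable setT (EFin \o (fun x => f (x - b))).
Proof.
move=> fi; have := integrable_affine (- b) (oner_neq0 R) fi.
by congr (integrable _ _ _); apply/funext => x /=; rewrite mul1r.
Qed.

(** The key to everything about convolutions in L1: the inner integral over t is
    a translate of the integral of |f|. *)
Lemma tonelli_conv f g : measurable_fun [set: R] f ->
  measurable_fun [set: R] g ->
  (\int[mu]_t \int[mu]_s `|f (t - s) * g s|%:E =
   (\int[mu]_t `|f t|%:E) * (\int[mu]_s `|g s|%:E))%E.
Proof.
move=> mf mg.
have mF : measurable_fun [set: R * R]
    (fun p : R * R => `|f (p.1 - p.2) * g p.2|%:E).
  apply/measurable_EFinP; apply: (measurableT_comp (@normr_measurable R setT)).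
  exact: measurable_conv_kernel.
have /= -> := @fubini_tonelli _ _ _ _ _ mu mu _ mF (fun=> normr_ge0 _).
have mnf : measurable_fun [set: R] (fun t => `|f t|%:E).
  by apply/measurable_EFinP; exact: measurableT_comp.
have mng : measurable_fun [set: R] (fun t => `|g t|%:E).
  by apply/measurable_EFinP; exact: measurableT_comp.
rewrite -ge0_integralZl//; last exact: integral_ge0.
apply: eq_integral => s _.
under eq_integral do rewrite normrM mulrC EFinM.
rewrite ge0_integralZl//; last first.
  apply/measurable_EFinP; apply: (measurableT_comp (@normr_measurable R setT)).
  by apply: (measurableT_comp mf); exact: measurable_funB.
rewrite muleC; congr (_ * _)%E.
rewrite -[RHS](@integral_isometry R 1 (- s) (fun t => `|f t|%:E) (normr1 _))//.
by apply: eq_integral => x _; rewrite mul1r.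
Qed.

Lemma integrable_conv_kernel f g :
  mu.-integrable setT (EFin \o f) -> mu.-integrable setT (EFin \o g) ->
  (mu \x mu)%E.-integrable [set: R * R]
    (fun p : R * R => (f (p.1 - p.2) * g p.2)%:E).
Proof.
move=> /integrableP[/measurable_EFinP mf fi] /integrableP[/measurable_EFinP mg gi].
apply/integrable12ltyP.
  by apply/measurable_EFinP; exact: measurable_conv_kernel.
rewrite (_ : (\int[_]_x _)%E = (\int[mu]_t \int[mu]_s `|f (t - s) * g s|%:E)%E)//.
rewrite tonelli_conv// lte_mul_pinfty//; first exact: integral_ge0.
by rewrite ge0_fin_numE ?integral_ge0.
Qed.

Lemma integrable_measurable f : mu.-integrable setT (EFin \o f) ->
  measurable_fun [set: R] f.
Proof. by case/integrableP => /measurable_EFinP. Qed.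

(** No integrability is asked for: when the right-hand side is infinite there is
    nothing to prove. *)
Lemma le_normr_Rintegral_ereal f : measurable_fun [set: R] f ->
  (`|\int[mu]_s f s|%:E <= \int[mu]_s `|f s|%:E)%E.
Proof.
move=> mf; rewrite /Rintegral.
have mf' : measurable_fun [set: R] (EFin \o f) by exact/measurable_EFinP.
apply: le_trans (le_abse_integral mu measurableT mf').
have H (I : \bar R) : (`|fine I|%:E <= `|I|)%E by case: I => [r| |] //=; rewrite normr0 leey.
exact: H.
Qed.

Lemma measurable_conv_section f g t : measurable_fun [set: R] f ->
  measurable_fun [set: R] g -> measurable_fun [set: R] (fun s => f (t - s) * g s).
Proof.
move=> mf mg; apply: measurable_funM => //.
by apply: (measurableT_comp mf); exact: measurable_funB.
Qed.

Lemma norm_conv_le f g : measurable_fun [set: R] f ->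
  measurable_fun [set: R] g ->
  (\int[mu]_t `|conv f g t|%:E <=
   (\int[mu]_t `|f t|%:E) * (\int[mu]_s `|g s|%:E))%E.
Proof.
move=> mf mg; rewrite -tonelli_conv//; apply: ge0_le_integral => //.
- by apply/measurable_EFinP; apply: measurableT_comp => //; exact: measurable_conv.
- have mF : measurable_fun [set: R * R]
    (fun p : R * R => `|f (p.1 - p.2) * g p.2|%:E).
    apply/measurable_EFinP; apply: (measurableT_comp (@normr_measurable R setT)).
    exact: measurable_conv_kernel.
  exact: (@measurable_fun_fubini_tonelli_F _ _ _ _ R mu _ mF (fun=> normr_ge0 _)).
- by move=> t _; apply: le_normr_Rintegral_ereal; exact: measurable_conv_section.
Qed.

Lemma integrable_conv f g :
  mu.-integrable setT (EFin \o f) -> mu.-integrable setT (EFin \o g) ->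
  mu.-integrable setT (EFin \o conv f g).
Proof.
move=> /integrableP[/measurable_EFinP mf fi] /integrableP[/measurable_EFinP mg gi].
apply/integrableP; split; first by apply/measurable_EFinP; exact: measurable_conv.
apply: le_lt_trans (norm_conv_le mf mg) _.
rewrite lte_mul_pinfty//; first exact: integral_ge0.
by rewrite ge0_fin_numE ?integral_ge0.
Qed.

(** Fubini; combined with an exponential weight this is the multiplicativity of
    the Laplace transform. *)
Lemma Rintegral_conv f g :
  mu.-integrable setT (EFin \o f) -> mu.-integrable setT (EFin \o g) ->
  \int[mu]_t conv f g t = (\int[mu]_t f t) * (\int[mu]_t g t).
Proof.
move=> fi gi; have [mf mg] := (integrable_measurable fi, integrable_measurable gi).
have Ki := integrable_conv_kernel fi gi.
have ffin := integrable_fin_num measurableT fi.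
have gfin := integrable_fin_num measurableT gi.
rewrite /Rintegral -fineM//; congr fine.
transitivity (\int[mu]_t \int[mu]_s (f (t - s) * g s)%:E)%E.
  apply: ae_eq_integral => //.
  - by apply/measurable_EFinP; exact: measurable_conv.
  - by case/integrableP : (integrable_fubini_F Ki).
  - apply: filterS (ae_integrable1 Ki) => t it _.
    by rewrite /conv /Rintegral fineK//; exact: integrable_fin_num it.
have /= -> := Fubini Ki.
transitivity (\int[mu]_s ((\int[mu]_t f t)%R%:E * (g s)%:E))%E; last first.
  by rewrite integralZl// /Rintegral fineK.
apply: eq_integral => s _.
under eq_integral do rewrite mulrC EFinM.
rewrite integralZl//; last exact: (integrable_shift s fi).
rewrite muleC -(Rintegral_shift s mf) /Rintegral fineK//.
exact: integrable_fin_num (integrable_shift s fi).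
Qed.

End convolution.

Section convolution_assoc.
Context {R : realType}.
Local Notation mu := (@lebesgue_measure R).
Implicit Types f g h : R -> R.

Lemma measurable_norm_EFin d (T : measurableType d) (u : T -> R) :
  measurable_fun setT u -> measurable_fun setT (fun x => `|u x|%:E).
Proof.
by move=> mu'; apply/measurable_EFinP; apply: (measurableT_comp (@normr_measurable R setT) mu').
Qed.

Lemma convC f g t : measurable_fun [set: R] f -> measurable_fun [set: R] g ->
  conv f g t = conv g f t.
Proof.
move=> mf mg; rewrite /conv -(Rintegral_reflect t (measurable_conv_section t mf mg)).
by apply: eq_Rintegral => s _; rewrite subKr mulrC.
Qed.

(** The inner kernels need not be integrable on the line, since the fractional
    kernel is not; it is enough for Fubini that |f| convolved with |g| is bounded at the
    points t - r with h r nonzero. *)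
Lemma conv_assoc f g h t (M : R) : measurable_fun [set: R] f ->
  measurable_fun [set: R] g -> mu.-integrable setT (EFin \o h) ->
  (forall r, h r != 0%R ->
     \int[mu]_s `|f (t - r - s) * g s|%:E <= M%:E)%E ->
  mu.-integrable setT (EFin \o (fun s => f (t - s) * conv g h s)) /\
  conv f (conv g h) t = conv (conv f g) h t.
Proof.
move=> mf mg hi fgM; have mh := integrable_measurable hi.
pose F (p : R * R) := f (t - p.1) * (g (p.1 - p.2) * h p.2).
have mF' : measurable_fun [set: R * R] F.
  apply: measurable_funM; last exact: measurable_conv_kernel.
  by apply: (measurableT_comp mf); exact: measurable_funB.
have mF : measurable_fun [set: R * R] (fun p => (F p)%:E) by exact/measurable_EFinP.
have mFr r : measurable_fun [set: R] (fun s => f (t - s) * g (s - r)).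
  apply: measurable_funM; first by apply: (measurableT_comp mf); exact: measurable_funB.
  by apply: (measurableT_comp mg); exact: measurable_funB.
have shift_section r : (\int[mu]_s `|f (t - s) * g (s - r)|%:E =
    \int[mu]_s `|f (t - r - s) * g s|%:E)%E.
  rewrite -[RHS](@integral_isometry R 1 (- r) (fun s => `|f (t - r - s) * g s|%:E) (normr1 _)).
    by apply: eq_integral => s _; rewrite mul1r (_ : t - r - (s - r) = t - s)//; ring.
  exact: (measurable_norm_EFin (measurable_conv_section _ mf mg)).
have FE r : (\int[mu]_s `|(F (s, r))%:E| =
    `|h r|%:E * \int[mu]_s `|f (t - r - s) * g s|%:E)%E.
  rewrite -shift_section -ge0_integralZl//.
    by apply: eq_integral => s _; rewrite /F /= -EFinM -normrM; congr (`|_|%:E); ring.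
  exact: (measurable_norm_EFin (mFr r)).
(* The section of F at r has L1 norm at most M |h r|, hence Fubini applies to F. *)
have Fi : (mu \x mu)%E.-integrable [set: R * R] (fun p => (F p)%:E).
  apply/integrable21ltyP; first exact: mF.
  under eq_integral do rewrite FE.
  case/integrableP : hi => _; move=> hi.
  apply: (@le_lt_trans _ _ (\int[mu]_r (`|M|%:E * `|h r|%:E)))%E.
    apply: ge0_le_integral => //.
    - by move=> r _; rewrite mule_ge0// integral_ge0.
    - have mnF := measurable_norm_EFin mF'.
      have := @measurable_fun_fubini_tonelli_G _ _ _ _ R mu _ mnF (fun=> normr_ge0 _).
      by congr (measurable_fun _ _); apply/funext => r; rewrite -FE.
    - by apply/measurable_EFinP; apply: measurable_funM => //; exact: measurableT_comp.
    - move=> r _; rewrite muleC; have [->|hr] := eqVneq (h r) 0.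
        by rewrite normr0 !mule0.
      by rewrite lee_wpmul2r//; apply: le_trans (fgM _ hr) _; rewrite lee_fin ler_norm.
  rewrite ge0_integralZl//; last by apply/measurable_EFinP; exact: measurableT_comp.
  by rewrite lte_mul_pinfty.
have aeF : ae_eq mu setT (fun s => \int[mu]_r (F (s, r))%:E)%E
    (EFin \o (fun s => f (t - s) * conv g h s)).
  apply: filterS (ae_integrable1 Fi) => s Fs _.
  rewrite /F/=; have [f0|f0] := eqVneq (f (t - s)) 0.
    by rewrite f0; under eq_integral do rewrite mul0r; rewrite integral0 mul0r.
  have gi : mu.-integrable setT (EFin \o (fun r => g (s - r) * h r)).
    have := integrableZl measurableT (f (t - s))^-1 Fs.
    apply: eq_integrable => // r _; rewrite /F /= -EFinM; congr EFin.
    by rewrite mulKf.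
  under eq_integral do rewrite EFinM.
  rewrite integralZl//= EFinM; congr (_ * _)%E.
  by rewrite /conv /Rintegral fineK//; exact: integrable_fin_num gi.
have mL : measurable_fun setT (EFin \o (fun s => f (t - s) * conv g h s)).
  apply/measurable_EFinP; apply: measurable_conv_section => //; exact: measurable_conv.
have Li := integrable_fubini_F Fi.
have mLi : measurable_fun setT (fun s => \int[mu]_r (F (s, r))%:E)%E by case/integrableP : Li.
split.
  apply/integrableP; split => //; case/integrableP : Li => _; apply: le_lt_trans.
  rewrite le_eqVlt; apply/orP; left; apply/eqP; apply: ae_eq_integral => //.
  - exact: measurableT_comp.
  - exact: measurableT_comp.
  - by apply: filterS aeF => s E _; rewrite /fubini_F E.
transitivity (fine (\int[mu]_s \int[mu]_r (F (s, r))%:E)%E).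
  by congr fine; apply/esym/ae_eq_integral.
have /= -> := Fubini Fi; congr fine.
apply: eq_integral => r _; have [h0|h0] := eqVneq (h r) 0.
  by rewrite /F /= h0 mulr0; under eq_integral do rewrite !mulr0; rewrite integral0.
have fgi : mu.-integrable setT (EFin \o (fun s => f (t - s) * g (s - r))).
  apply/integrableP; split; first by apply/measurable_EFinP; exact: (mFr r).
  by rewrite [X in (X < _)%E]shift_section; apply: le_lt_trans (fgM _ h0) _; rewrite ltry.
rewrite /F /=; under eq_integral do rewrite mulrA EFinM.
rewrite integralZr// EFinM; congr (_ * _)%E.
transitivity ((\int[mu]_s (f (t - s) * g (s - r)))%:E)%E.
  by rewrite /Rintegral fineK//; exact: integrable_fin_num fgi.
congr EFin; rewrite /conv -(Rintegral_shift r (measurable_conv_section (t - r) mf mg)).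
by apply: eq_Rintegral => s _; congr (f _ * _); ring.
Qed.

End convolution_assoc.

(** * Fractional kernels and the Gamma function *)

Section kernels.
Context {R : realType}.
Local Notation mu := (@lebesgue_measure R).
Implicit Types (z t lam : R).

(** The value at 0 is 0, so that causal kernels vanish on the closed negative
    half-line. *)
Definition heaviside : R -> R := \1_(`]0, +oo[%classic).

(** Causal power function, whose Laplace transform at 1 is Gamma z. *)
Definition pkern z t : R := heaviside t * t `^ (z - 1).

(** Kernel of the Riemann-Liouville fractional integral of order z. *)
Definition fkern z t : R := (Gamma z)^-1 * pkern z t.

Lemma heavisideE t : heaviside t = (0 < t)%R%:R.
Proof.
rewrite /heaviside indicE (_ : (t \in _) = (0 < t))//.
by apply/idP/idP; rewrite inE /= in_itv /= andbT.
Qed.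

Lemma measurable_heaviside : measurable_fun [set: R] heaviside.
Proof. exact: measurable_indic. Qed.

Lemma measurable_pkern z : measurable_fun [set: R] (pkern z).
Proof.
by apply: measurable_funM; [exact: measurable_heaviside|exact: measurable_powR].
Qed.

Lemma measurable_fkern z : measurable_fun [set: R] (fkern z).
Proof. by apply: measurable_funM => //; exact: measurable_pkern. Qed.

Lemma heaviside_ge0 t : 0 <= heaviside t.
Proof. by rewrite heavisideE. Qed.

Lemma pkern_ge0 z t : 0 <= pkern z t.
Proof. by rewrite mulr_ge0 ?powR_ge0 ?heaviside_ge0. Qed.

Lemma powR_continuous_at (r x : R) : 0 < x -> {for x, continuous (@powR R ^~ r)}.
Proof.
move=> x0; apply: differentiable_continuous; apply/derivable1_diffP.
by apply: derivable_powR; rewrite in_itv /= andbT.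
Qed.

Lemma integral_powR_itv z (a : R) : 0 < z -> 0 < a -> a < 1 ->
  (\int[mu]_(u in `[a, 1%R]) (u `^ (z - 1))%:E <= (z^-1)%:E)%E.
Proof.
move=> z0 a0 a1.
rewrite (@continuous_FTC2 _ _ (fun u => z^-1 * u `^ z))//.
- by rewrite -EFinB lee_fin powR1 mulr1 gerBl mulr_ge0 ?powR_ge0// invr_ge0 ltW.
- apply: continuous_in_subspaceT => x; rewrite inE /= in_itv /= => /andP[ax _].
  by apply: powR_continuous_at; exact: lt_le_trans ax.
- have cF (x : R) : 0 < x -> {for x, continuous (fun u : R => z^-1 * u `^ z)}.
    by move=> x0; apply: continuousM; [exact: cvg_cst|exact: powR_continuous_at].
  split.
  + move=> x; rewrite in_itv /= => /andP[ax _]; apply: derivableM => //.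
    by apply: derivable_powR; rewrite in_itv /= andbT (lt_trans a0).
  + by apply: cvg_at_right_filter; exact: cF.
  + by apply: cvg_at_left_filter; exact: cF.
- move=> x; rewrite in_itv /= => /andP[ax _].
  have x0 : 0 < x by exact: lt_trans ax.
  have dx := is_derive1_powR z x0.
  rewrite derive1E deriveM// derive_cst scaler0 addr0 derive_val.
  by rewrite /GRing.scale /= mulrA mulVf ?mul1r// gt_eqF.
Qed.

(** Integrability of the singularity at 0, by exhausting the interval from inside. *)
Lemma integral_powR01 z : 0 < z ->
  (\int[mu]_(u in `]0%R, 1%R]) (u `^ (z - 1))%:E <= (z^-1)%:E)%E.
Proof.
move=> z0; pose F (i : nat) : set R := `[i.+2%:R^-1, 1]%classic.
have -> : `]0, 1]%classic = \bigcup_i F i.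
  apply/seteqP; split => x /=; rewrite in_itv /=.
    move=> /andP[x0 x1]; exists (Num.truncn x^-1) => //=.
    rewrite /F /= in_itv /= x1 andbT -[leRHS]invrK lef_pV2 ?posrE ?invr_gt0//.
    by rewrite ltW// (lt_le_trans (truncnS_gt _))// ler_nat.
  move=> [i _]; rewrite /F /= in_itv /= => /andP[xi ->]; rewrite andbT.
  by rewrite (lt_le_trans _ xi).
have mf : measurable_fun [set: R] (fun u : R => (u `^ (z - 1))%:E).
  by apply/measurable_EFinP; exact: measurable_powR.
have H : (\int[mu]_(x in F i) (x `^ (z - 1))%:E @[i --> \oo] -->
          \int[mu]_(x in \bigcup_i F i) (x `^ (z - 1))%:E)%E.
  apply: ge0_nondecreasing_set_cvg_integral => //.
  - apply/nondecreasing_seqP => n; rewrite subsetEset => x; rewrite /F /= !in_itv /=.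
    by move=> /andP[xn ->]; rewrite andbT (le_trans _ xn)// lef_pV2 ?posrE// ler_nat.
  - by move=> i; exact: measurable_itv.
  - by move=> i; exact: measurable_funTS.
  - by move=> i x _; rewrite lee_fin powR_ge0.
rewrite -(cvg_lim _ H)//; apply: lime_le; first by apply/cvg_ex; eexists; exact: H.
by apply: nearW => i; apply: integral_powR_itv => //; rewrite invf_lt1 ?ltr1n.
Qed.

End kernels.

Section gamma.
Context {R : realType}.
Local Notation mu := (@lebesgue_measure R).
Implicit Types (z t lam : R).

(** The weight e^(-lam t), both for Laplace transforms and for the norms in which
    the Volterra operator is a contraction. *)
Definition ew lam t : R := expR (- lam * t).

Lemma ew_gt0 lam t : 0 < ew lam t. Proof. exact: expR_gt0. Qed.

Lemma ewB lam t s : ew lam t = ew lam (t - s) * ew lam s.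
Proof. by rewrite /ew -expRD -mulrDr subrK. Qed.

Lemma measurable_ew lam : measurable_fun [set: R] (ew lam).
Proof. by apply: (measurableT_comp (@measurable_expR R)); apply: measurable_funM. Qed.

Lemma powR_ge1 (u r : R) : 0 < u -> u <= 1 -> r <= 0 -> 1 <= u `^ r.
Proof.
move=> u0 u1 r0; rewrite /powR gt_eqF// -expR0 ler_expR mulr_le0//.
exact: ln_le0.
Qed.

Lemma powR_le1 (u r : R) : 1 <= u -> r <= 0 -> u `^ r <= 1.
Proof.
move=> u1 r0; have u0 : 0 < u by exact: lt_le_trans u1.
by rewrite /powR gt_eqF// -expR0 ler_expR mulr_le0_ge0// ln_ge0.
Qed.

(** The total mass of the exponential law. *)
Lemma laplace_heaviside lam : 0 < lam ->
  (\int[mu]_t (ew lam t * heaviside t)%:E = (lam^-1)%:E)%E.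
Proof.
move=> lam0.
have := integral_exponential_pdf lam0.
have E : (\int[mu]_t (ew lam t * heaviside t)%:E =
  \int[mu]_(t in `]0%R, +oo[) (ew lam t)%:E)%E.
  rewrite [RHS]integral_mkcond; apply: eq_integral => t _.
  by rewrite /heaviside indicE patchE; case: (_ \in _); rewrite ?mulr1 ?mulr0.
rewrite E integral_itv_obnd_cbnd; last first.
  by apply: measurable_funTS; apply/measurable_EFinP; exact: measurable_ew.
rewrite (_ : (\int[mu]_x _)%E = (\int[mu]_(x in `[0%R, +oo[) (lam%:E * (ew lam x)%:E))%E); last first.
  rewrite [RHS]integral_mkcond; apply: eq_integral => x _.
  by rewrite /exponential_pdf !patchE; case: (_ \in _).
rewrite ge0_integralZl//=; last 3 first.
- by apply: measurable_funTS; apply/measurable_EFinP; exact: measurable_ew.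
- by move=> x _; rewrite lee_fin expR_ge0.
- by rewrite lee_fin ltW.
move=> /(congr1 (fun x => (lam^-1)%:E * x)%E).
by rewrite muleA -EFinM mulVf ?gt_eqF// mul1e mule1.
Qed.

(** Euler's integral as an integral over the line; it is an extended real so that
    Tonelli can be applied to it without integrability conditions. *)
Definition Gamma_integral z : \bar R := (\int[mu]_u (ew 1 u * pkern z u)%:E)%E.

Lemma measurable_ew_pkern lam z : measurable_fun [set: R] (fun u => (ew lam u * pkern z u)%:E).
Proof.
apply/measurable_EFinP/measurable_funM; first exact: measurable_ew.
exact: measurable_pkern.
Qed.

Lemma Gamma_integral_lty z : 0 < z -> z <= 1 -> (Gamma_integral z < +oo)%E.
Proof.
move=> z0 z1.
have m1 : measurable_fun [set: R] (fun u => (\1_(`]0, 1]%classic : set R) u * u `^ (z - 1))%:E).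
  apply/measurable_EFinP/measurable_funM; last exact: measurable_powR.
  exact: measurable_indic.
have m2 : measurable_fun [set: R] (fun u => (ew 1 u * heaviside u)%:E).
  apply/measurable_EFinP/measurable_funM; first exact: measurable_ew.
  exact: measurable_heaviside.
apply: (@le_lt_trans _ _ (\int[mu]_u ((\1_(`]0%R, 1%R]%classic : set R) u * u `^ (z - 1))%:E +
   (ew 1 u * heaviside u)%:E))%E).
  apply: ge0_le_integral => //.
  - by move=> u _; rewrite lee_fin mulr_ge0 ?pkern_ge0// ltW// ew_gt0.
  - exact: measurable_ew_pkern.
  - exact: emeasurable_funD.
  - move=> u _; rewrite -EFinD lee_fin /pkern heavisideE.
    have [u0|u0] := ltP 0 u; last first.
      by rewrite mul0r !mulr0 addr0 mulr_ge0 ?powR_ge0// indicE.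
    rewrite mul1r mulr1; have e1 : ew 1 u <= 1.
      by rewrite /ew -[leRHS]expR0 ler_expR mulNr mul1r oppr_le0 ltW.
    have [u1|u1] := leP u 1.
      rewrite indicE mem_set /= ?in_itv /= ?u0 ?u1// mul1r.
      by rewrite ler_wpDr ?(ltW (ew_gt0 _ _))// ler_piMl ?powR_ge0.
    rewrite ler_wpDl ?mulr_ge0 ?powR_ge0 ?indicE//.
    by rewrite ler_piMr ?(ltW (ew_gt0 _ _))// powR_le1 ?(ltW u1)// subr_le0.
rewrite ge0_integralD//; last 2 first.
- by move=> u _; rewrite lee_fin mulr_ge0 ?powR_ge0// indicE.
- by move=> u _; rewrite lee_fin mulr_ge0 ?heaviside_ge0// ltW// ew_gt0.
rewrite laplace_heaviside// lte_add_pinfty ?ltry//.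
apply: le_lt_trans (ltry z^-1); apply: le_trans (integral_powR01 z0).
rewrite [leRHS]integral_mkcond le_eqVlt; apply/orP; left; apply/eqP/eq_integral => u _.
by rewrite patchE indicE; case: (_ \in _); rewrite ?mul1r ?mul0r.
Qed.

Lemma GammaE z : 0 < z -> z <= 1 -> ((Gamma z)%:E = Gamma_integral z)%E.
Proof.
move=> z0 z1; have -> : Gamma z = fine (Gamma_integral z).
  rewrite /Gamma Rintegral_mkcond /Rintegral; congr fine; apply: eq_integral => u _.
  rewrite patchE /pkern /heaviside indicE /ew mulNr mul1r.
  by case: (_ \in _); rewrite ?mul1r ?mul0r ?mulr0// mulrC.
rewrite fineK// ge0_fin_numE ?Gamma_integral_lty//; apply: integral_ge0 => u _.
by rewrite lee_fin mulr_ge0 ?pkern_ge0// ltW// ew_gt0.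
Qed.

Lemma Gamma_gt0 z : 0 < z -> z <= 1 -> 0 < Gamma z.
Proof.
move=> z0 z1; rewrite -lte_fin GammaE//.
apply: (@lt_le_trans _ _ (\int[mu]_(u in `]0%R, 1%R]) (expR (-1))%:E)%E).
  rewrite integral_cst//= lebesgue_measure_itv /= lte_fin ltr01 -EFinB subr0.
  by rewrite mule1 lte_fin expR_gt0.
apply: (@le_trans _ _ (\int[mu]_(u in `]0%R, 1%R]) (ew 1 u * pkern z u)%:E)%E).
  apply: ge0_le_integral => //.
  - by apply: measurable_funTS; exact: measurable_ew_pkern.
  - move=> u /=; rewrite in_itv /= => /andP[u0 u1]; rewrite lee_fin /pkern heavisideE u0 mul1r.
    apply: (@le_trans _ _ (ew 1 u)); first by rewrite /ew ler_expR mulNr mul1r lerN2.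
    by rewrite ler_peMr ?(ltW (ew_gt0 _ _))// powR_ge1// subr_le0.
apply: ge0_subset_integral => //; first exact: measurable_ew_pkern.
by move=> u _; rewrite lee_fin mulr_ge0 ?pkern_ge0// ltW// ew_gt0.
Qed.

End gamma.

Section kernel_identities.
Context {R : realType}.
Local Notation mu := (@lebesgue_measure R).
Implicit Types (z t lam : R).

Lemma powR_add (x r s : R) : 0 < x -> x `^ (r + s) = x `^ r * x `^ s.
Proof. by move=> x0; rewrite powRD//; apply/implyP => _; rewrite gt_eqF. Qed.

Lemma heaviside_scale lam t : 0 < lam -> heaviside (lam * t) = heaviside t.
Proof. by move=> l0; rewrite !heavisideE pmulr_rgt0. Qed.

Lemma pkern_scale z lam t : 0 < lam -> pkern z (lam * t) = lam `^ (z - 1) * pkern z t.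
Proof.
move=> l0; rewrite /pkern heaviside_scale// heavisideE.
have [t0|t0] := ltP 0 t; last by rewrite !mul0r mulr0.
by rewrite !mul1r powRM ?ltW.
Qed.

(** By the substitution u = lam t, which rescales the power. *)
Lemma laplace_pkern lam z : 0 < lam -> 0 < z -> z <= 1 ->
  (\int[mu]_t (ew lam t * pkern z t)%:E = (lam `^ (- z) * Gamma z)%:E)%E.
Proof.
move=> l0 z0 z1; rewrite EFinM GammaE//.
have l1 : lam `^ (- z) = lam `^ (1 - z) * lam^-1.
  by rewrite -powR_inv1 ?ltW// -powR_add//; congr (lam `^ _); ring.
rewrite l1 EFinM -muleA.
have -> : (lam^-1%:E = `|lam|^-1%:E)%E by rewrite gtr0_norm.
rewrite -(@ge0_integral_affine R lam 0 (fun u => (ew 1 u * pkern z u)%:E))//.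
- rewrite -ge0_integralZl//.
  + apply: eq_integral => t _; rewrite addr0 pkern_scale// -EFinM; congr EFin.
    have -> : ew lam t = ew 1 (lam * t) by rewrite /ew mulN1r mulNr.
    rewrite [RHS]mulrCA [X in _ = _ * X]mulrA -powR_add//.
    by rewrite (_ : 1 - z + (z - 1) = 0) ?powRr0 ?mul1r//; ring.
  + apply: (measurableT_comp (measurable_ew_pkern 1 z)); exact: measurable_affine.
  + by move=> u _; rewrite lee_fin mulr_ge0 ?pkern_ge0// ltW// ew_gt0.
  + by rewrite lee_fin powR_ge0.
- by rewrite gt_eqF.
- exact: measurable_ew_pkern.
- by move=> u; rewrite lee_fin mulr_ge0 ?pkern_ge0// ltW// ew_gt0.
Qed.

Lemma fkern_ge0 z t : 0 < z -> z <= 1 -> 0 <= fkern z t.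
Proof. by move=> z0 z1; rewrite mulr_ge0 ?pkern_ge0// invr_ge0 ltW// Gamma_gt0. Qed.

Lemma fkern_le0 z t : t <= 0 -> fkern z t = 0.
Proof. by move=> t0; rewrite /fkern /pkern heavisideE ltNge t0 mul0r mulr0. Qed.

Lemma laplace_fkern lam z : 0 < lam -> 0 < z -> z <= 1 ->
  (\int[mu]_t (ew lam t * fkern z t)%:E = (lam `^ (- z))%:E)%E.
Proof.
move=> l0 z0 z1; have G0 := Gamma_gt0 z0 z1.
under eq_integral do rewrite /fkern mulrCA EFinM.
rewrite ge0_integralZl//.
- by rewrite laplace_pkern// -EFinM mulrCA mulVf ?mulr1// gt_eqF.
- exact: measurable_ew_pkern.
- by move=> u _; rewrite lee_fin mulr_ge0 ?pkern_ge0// ltW// ew_gt0.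
- by rewrite lee_fin invr_ge0 ltW.
Qed.

(** The orders 1 - z and z add up to 1, so that the two fractional integrals
    compose to the ordinary one. This is the Beta integral B(1 - z, z) in disguise,
    and the reason why the Caputo derivative inverts the fractional integral. *)
Lemma conv_fkern z r : 0 < z -> z < 1 ->
  (\int[mu]_s `|fkern (1 - z) (r - s) * fkern z s|%:E = (heaviside r)%:E)%E.
Proof.
move=> z0 z1; have y0 : 0 < 1 - z by rewrite subr_gt0.
have y1 : 1 - z <= 1 by rewrite gerBl ltW.
pose b t := (\int[mu]_s (pkern (1 - z) (t - s) * pkern z s)%:E)%E.
have b_ge0 t : (0 <= b t)%E.
  by apply: integral_ge0 => s _; rewrite lee_fin mulr_ge0// pkern_ge0.
(* The exponents add up to -1, so the substitution s := t s' shows that the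
   convolution of the two powers does not depend on t > 0. *)
have bE t : (b t = (heaviside t)%:E * b 1%R)%E.
  rewrite heavisideE; have [t0|t0] := ltP 0 t; last first.
    rewrite mul0e /b; under eq_integral => s _.
      rewrite (_ : _ * _ = 0); first over.
      rewrite /pkern !heavisideE; have [s0|s0] := ltP 0 s; last by rewrite mul0r mulr0.
      by rewrite (_ : (0 < t - s) = false) ?mul0r//; apply/negbTE; rewrite -leNgt; lra.
    by rewrite integral0.
  rewrite mul1e /b.
  have mk : measurable_fun [set: R] (fun s => (pkern (1 - z) (t - s) * pkern z s)%:E).
    by apply/measurable_EFinP; apply: measurable_conv_section; exact: measurable_pkern.
  have k0 s : (0 <= (pkern (1 - z) (t - s) * pkern z s)%:E)%E by rewrite lee_fin mulr_ge0// pkern_ge0.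
  have E := @ge0_integral_affine R t 0 _ (lt0r_neq0 t0) mk k0.
  have tK (x : \bar R) : (t%:E * (`|t|^-1%:E * x) = x)%E.
    by rewrite muleA -EFinM gtr0_norm// mulfV ?gt_eqF// mul1e.
  rewrite -[LHS]tK -E.
  rewrite -ge0_integralZl//.
  - apply: eq_integral => s _; rewrite addr0 -EFinM; congr EFin.
    rewrite (_ : t - t * s = t * (1 - s)); last by ring.
    rewrite !pkern_scale// mulrACA mulrA -powR_add//.
    rewrite (_ : 1 - z - 1 + (z - 1) = -1); last by ring.
    by rewrite powR_inv1 ?ltW// !mulrA mulfV ?gt_eqF// mul1r.
  - by apply: (measurableT_comp mk); exact: measurable_affine.
  - by rewrite lee_fin ltW.
(* Its value comes from Tonelli applied to the convolution weighted by e^-t: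
   the constant b 1 is integrated against e^-t, whose integral is 1. *)
have b1E : (b 1%R = (Gamma (1 - z) * Gamma z)%:E)%E.
  rewrite EFinM !GammaE//; last exact: ltW.
  have mew x : measurable_fun [set: R] (fun u => ew 1 u * pkern x u).
    apply: measurable_funM; [exact: measurable_ew|exact: measurable_pkern].
  have pos x u : (0 <= ew 1 u * pkern x u :> R).
    by rewrite mulr_ge0 ?pkern_ge0// ltW// ew_gt0.
  have := tonelli_conv (mew (1 - z)) (mew z).
  rewrite (_ : \int[mu]_t `|ew 1 t * pkern (1 - z) t|%:E = Gamma_integral (1 - z))%E; last first.
    by apply: eq_integral => u _; rewrite ger0_norm.
  rewrite (_ : \int[mu]_t `|ew 1 t * pkern z t|%:E = Gamma_integral z)%E; last first.
    by apply: eq_integral => u _; rewrite ger0_norm.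
  move=> <-; transitivity (\int[mu]_t ((ew 1 t * heaviside t)%:E * b 1%R))%E.
    rewrite ge0_integralZr//.
    - by rewrite laplace_heaviside// invr1 mul1e.
    - apply/measurable_EFinP/measurable_funM; first exact: measurable_ew.
      exact: measurable_heaviside.
    - by move=> u _; rewrite lee_fin mulr_ge0 ?heaviside_ge0// ltW// ew_gt0.
  apply: eq_integral => t _; rewrite EFinM -muleA -bE /b -ge0_integralZl//.
  - apply: eq_integral => s _; rewrite ger0_norm; last exact: (mulr_ge0 (pos _ _) (pos _ _)).
    by rewrite -EFinM; congr EFin; rewrite (ewB 1 t s) mulrACA.
  - by apply/measurable_EFinP; apply: measurable_conv_section; exact: measurable_pkern.
  - by move=> s _; rewrite lee_fin mulr_ge0// pkern_ge0.
  - by rewrite lee_fin ltW// ew_gt0.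
have G1 := Gamma_gt0 y0 y1; have G2 := Gamma_gt0 z0 (ltW z1).
transitivity (((Gamma (1 - z))^-1 * (Gamma z)^-1)%:E * b r)%E.
  rewrite /b -ge0_integralZl//.
  - apply: eq_integral => s _; rewrite ger0_norm; last exact: (mulr_ge0 (fkern_ge0 _ y0 y1) (fkern_ge0 _ z0 (ltW z1))).
    by rewrite -EFinM /fkern mulrACA.
  - by apply/measurable_EFinP; apply: measurable_conv_section; exact: measurable_pkern.
  - by move=> s _; rewrite lee_fin mulr_ge0// pkern_ge0.
  - by rewrite lee_fin; apply: mulr_ge0; rewrite invr_ge0; apply: ltW.
rewrite bE b1E; move: (Gamma (1 - z)) (Gamma z) G1 G2 => g1 g2 G1 G2.
by rewrite -!EFinM; congr EFin; field; rewrite !gt_eqF.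
Qed.

End kernel_identities.

(** * A fixed point theorem in weighted L1 *)

Section weighted_fixpoint.
Context {R : realType}.
Local Notation mu := (@lebesgue_measure R).

Lemma ae_imp (P Q : R -> Prop) : (forall t, P t -> Q t) ->
  {ae mu, forall t, P t} -> {ae mu, forall t, Q t}.
Proof.
by move=> PQ; apply: filterS; first exact: (ae_filter_ringOfSetsType mu).
Qed.

Lemma ae_imp2 (P Q S : R -> Prop) : (forall t, P t -> Q t -> S t) ->
  {ae mu, forall t, P t} -> {ae mu, forall t, Q t} -> {ae mu, forall t, S t}.
Proof.
by move=> PQ; apply: filterS2; first exact: (ae_filter_ringOfSetsType mu).
Qed.

(** Fatou's lemma, to pass bounds on iterates to their almost everywhere limit. *)
Lemma fatou_bound (g_ : nat -> R -> R) (g : R -> R) (K : R) :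
  (forall n, measurable_fun [set: R] (g_ n)) -> measurable_fun [set: R] g ->
  (forall n t, 0 <= g_ n t) -> (forall t, 0 <= g t) ->
  {ae mu, forall t, g_ n t @[n --> \oo] --> g t} ->
  (forall n, \int[mu]_t (g_ n t)%:E <= K%:E)%E ->
  (\int[mu]_t (g t)%:E <= K%:E)%E.
Proof.
move=> mg_ mg g_0 g0 gcvg gK.
have m_ n : measurable_fun [set: R] (fun t => (g_ n t)%:E) by exact/measurable_EFinP.
have mi : measurable_fun [set: R] (fun t => limn_einf (fun n => (g_ n t)%:E)).
  rewrite [X in measurable_fun _ X](_ : _ = (fun t => - limn_esup (fun n => (- g_ n t)%:E))%E).
    apply: measurableT_comp => //; apply: measurable_fun_limn_esup => n.
    by apply/measurable_EFinP; exact: measurableT_comp.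
  by apply/funext => t; rewrite -limn_einfN; congr limn_einf; apply/funext => n /=; rewrite opprK.
apply: (@le_trans _ _ (\int[mu]_t limn_einf (fun n => (g_ n t)%:E)))%E.
  rewrite le_eqVlt; apply/orP; left; apply/eqP/ae_eq_integral => //.
    exact/measurable_EFinP.
  apply: ae_imp gcvg => t gt _.
  have cv : (g_ n t)%:E @[n --> \oo] --> (g t)%:E by apply: cvg_EFin; [exact: nearW|].
  by rewrite (cvg_limn_einf_sup cv).1.
apply: le_trans (fatou mu measurableT m_ (fun n t _ => g_0 n t)) _.
apply: le_trans (limn_einf_sup _) _.
rewrite limn_esup_lim; apply: lime_le; first exact: is_cvg_esups.
by apply: nearW => n; apply: ge_ereal_sup => _ [m _ <-]; exact: gK.
Qed.

Variables (E : set R) (w v : R -> R) (K : R) (Phi : (R -> R) -> R -> R).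
Hypothesis mw : measurable_fun [set: R] w.
Hypothesis w_gt0 : forall t, 0 < w t.
Let w_ge0 t : 0 <= w t. Proof. exact: ltW. Qed.
Hypothesis mv : measurable_fun [set: R] v.
Hypothesis v_ge0 : forall t, 0 <= v t.
Hypothesis w_le_v : forall t, E t -> w t <= v t.
Hypothesis K_ge0 : 0 <= K.

(** The ball is measured with a weight v that may differ from the weight w of the
    contraction: the Lipschitz constant of the map depends on the size of the
    ball, which has to be fixed before w is chosen. *)
Definition supp_ball (z : R -> R) :=
  [/\ measurable_fun [set: R] z, forall t, ~ E t -> z t = 0 &
      (\int[mu]_t (v t * `|z t|)%:E <= K%:E)%E].

Definition wnorm (u : R -> R) : \bar R := (\int[mu]_t (w t * `|u t|)%:E)%E.

Hypothesis Phi_ball : forall z, supp_ball z -> supp_ball (Phi z).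
Hypothesis Phi_contr : forall z z', supp_ball z -> supp_ball z' ->
  (wnorm (Phi z \- Phi z')%R <= (2^-1)%:E * wnorm (z \- z')%R)%E.

Lemma measurable_wnorm (u : R -> R) : measurable_fun [set: R] u ->
  measurable_fun [set: R] (fun t => w t * `|u t|).
Proof.
by move=> mu'; apply: measurable_funM => //; apply: measurableT_comp.
Qed.

Lemma wnorm_triangle (a b c : R -> R) : measurable_fun [set: R] a ->
  measurable_fun [set: R] b -> measurable_fun [set: R] c ->
  (wnorm (a \- c)%R <= wnorm (a \- b)%R + wnorm (b \- c)%R)%E.
Proof.
move=> ma mb mc.
have mab : measurable_fun [set: R] (fun t => (w t * `|a t - b t|)%:E).
  by apply/measurable_EFinP; apply: measurable_wnorm; exact: measurable_funB.
have mbc : measurable_fun [set: R] (fun t => (w t * `|b t - c t|)%:E).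
  by apply/measurable_EFinP; apply: measurable_wnorm; exact: measurable_funB.
have p (u : R -> R) t : 0 <= w t * `|u t| by rewrite mulr_ge0.
rewrite /wnorm -ge0_integralD//; first last.
- by move=> t _; rewrite lee_fin (p (b \- c)%R).
- by move=> t _; rewrite lee_fin (p (a \- b)%R).
apply: ge0_le_integral => //.
- by move=> t _; rewrite lee_fin (p (a \- c)%R).
- by apply/measurable_EFinP; apply: measurable_wnorm; exact: measurable_funB.
- exact: emeasurable_funD.
- move=> t _; rewrite -EFinD lee_fin -mulrDr ler_wpM2l// /=.
  by rewrite (le_trans _ (ler_normD _ _))// addrA subrK.
Qed.

Let z_ n := iter n Phi (cst 0).

Let ball_z n : supp_ball (z_ n).
Proof.
elim: n => [|n ih]; last exact: Phi_ball.
split => //=.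
by under eq_integral do rewrite normr0 mulr0; rewrite integral0.
Qed.

Let mz n : measurable_fun [set: R] (z_ n). Proof. by case: (ball_z n). Qed.

Let step n : (wnorm (z_ n.+1 \- z_ n)%R <= (K * 2^-1 ^+ n)%:E)%E.
Proof.
elim: n => [|n ih].
  rewrite expr0 mulr1; have [m1 z1 zK] := ball_z 1.
  apply: le_trans zK; apply: ge0_le_integral => //.
  - by move=> t _; rewrite lee_fin mulr_ge0.
  - by apply/measurable_EFinP; apply: measurable_wnorm; exact: measurable_funB.
  - by apply/measurable_EFinP; apply: measurable_funM => //; exact: measurableT_comp.
  - move=> t _; rewrite /= subr0 lee_fin.
    have [/w_le_v wt|/z1 /= ->] := pselect (E t); last by rewrite normr0 !mulr0.
    by rewrite ler_wpM2r.
apply: le_trans (Phi_contr (ball_z n.+1) (ball_z n)) _.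
by rewrite exprSr mulrA EFinM muleC lee_wpmul2r// lee_fin.
Qed.

Let cauchy n m : (wnorm (z_ (n + m) \- z_ n)%R <= (2 * K * 2^-1 ^+ n - 2 * K * 2^-1 ^+ (n + m))%:E)%E.
Proof.
elim: m => [|m ih].
  rewrite addn0 subrr /wnorm; under eq_integral do rewrite /= subrr normr0 mulr0.
  by rewrite integral0.
rewrite addnS; apply: le_trans (wnorm_triangle (mz _) (mz (n + m)) (mz _)) _.
apply: le_trans (leeD (step _) ih) _.
by rewrite -EFinD lee_fin (exprS _ (n + m)); lra.
Qed.

Let cvg_ae : {ae mu, forall t, cvgn (fun n => z_ n t)}.
Proof.
pose d n t := w t * `|z_ n.+1 t - z_ n t|.
have d0 n t : 0 <= d n t by rewrite mulr_ge0.
have md n : measurable_fun [set: R] (fun t => (d n t)%:E).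
  by apply/measurable_EFinP; apply: measurable_wnorm; exact: measurable_funB.
(* The weighted L1 norms of the increments are summable, hence so are the
   increments themselves at almost every point. *)
have Si : mu.-integrable setT (fun t => \big[+%E/0%R]_(0 <= n <oo) (d n t)%:E)%E.
  apply/integrableP; split.
    have := @ge0_emeasurable_sum _ _ R setT (fun n t => (d n t)%:E) xpredT
      (fun k t _ _ => d0 k t) (fun k _ => md k).
    by congr (measurable_fun _ _); apply/funext => t; apply: eq_eseriesl => n; rewrite inE.
  have S0 t : (0 <= \big[+%E/0%R]_(0 <= n <oo) (d n t)%:E)%E.
    by apply: nneseries_ge0 => n _ _; rewrite lee_fin.
  under eq_integral do rewrite (gee0_abs (S0 _)).
  rewrite integral_nneseries//; last by move=> n t _; rewrite lee_fin.
  apply: (@le_lt_trans _ _ (2 * K)%:E); last exact: ltry.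
  apply: lime_le; first by apply: is_cvg_nneseries => n _ _; apply: integral_ge0 => t _; rewrite lee_fin.
  apply: nearW => n.
  apply: (@le_trans _ _ (\sum_(0 <= i < n) (K * 2^-1 ^+ i)%:E)%E).
    by apply: lee_sum => i _; exact: step.
  rewrite sumEFin lee_fin -mulr_sumr mulrC ler_wpM2r//.
  have -> : \sum_(0 <= i < n) 2^-1 ^+ i = 2 - 2 * 2^-1 ^+ n :> R.
    elim: n => [|n ih]; first by rewrite big_geq// expr0 mulr1 subrr.
    by rewrite big_nat_recr//= ih exprS; field.
  by rewrite gerBl mulr_ge0// exprn_ge0.
apply: ae_imp (integrable_ae measurableT Si) => t /(_ I) Sfin.
have : cvgn (series (fun n => `|z_ n.+1 t - z_ n t|)).
  apply: nondecreasing_is_cvgn.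
    by apply/nondecreasing_seqP => n; rewrite /series /= big_nat_recr//= lerDl.
  exists ((w t)^-1 * fine (\big[+%E/0%R]_(0 <= n <oo) (d n t)%:E)%E) => _ [n _ <-].
  rewrite ler_pdivlMl// /series /= mulr_sumr -lee_fin fineK// -sumEFin.
  exact: (@nneseries_lim_ge R (fun i => (d i t)%:E) xpredT 0 n (fun i _ _ => d0 i t)).
move=> /(@normed_cvg R R^o (telescope (fun n => z_ n t))) cvS.
rewrite (_ : (fun n => z_ n t) = (fun n => z_ 0%N t + series (telescope (fun n => z_ n t)) n)).
  by apply: is_cvgD => //; exact: is_cvg_cst.
by apply/funext => n; rewrite -eq_sum_telescope.
Qed.

(** Banach's fixed point theorem in a weighted L1 space, by Picard iteration from
    0. The increments have summable norms, so the iterates converge almost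
    everywhere; Fatou bounds both the limit and its distance to the iterates. *)
Lemma weighted_fixpoint : exists2 z, supp_ball z & {ae mu, forall t, Phi z t = z t}.
Proof.
pose z t := fine (limn_esup (fun n => (z_ n t)%:E)).
have mz' : measurable_fun [set: R] z.
  apply: measurableT_comp => //; apply: measurable_fun_limn_esup => n.
  exact/measurable_EFinP.
have zcvg : {ae mu, forall t, z_ n t @[n --> \oo] --> z t}.
  apply: ae_imp cvg_ae => t /cvg_ex[l zl].
  have zlE : (z_ n t)%:E @[n --> \oo] --> l%:E by apply: cvg_EFin => //; exact: nearW.
  by rewrite /z (cvg_limn_einf_sup zlE).2.
have zb : supp_ball z.
  split => //.
    move=> t Et; rewrite /z (_ : (fun n => _) = cst 0%E).
      by rewrite (cvg_limn_einf_sup (@cvg_cst _ _ _ _ _)).2.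
    by apply/funext => n; have [_ -> //] := ball_z n.
  apply: (@fatou_bound (fun n t => v t * `|z_ n t|)) => //.
  - by move=> n; apply: measurable_funM => //; exact: measurableT_comp.
  - by apply: measurable_funM => //; exact: measurableT_comp.
  - by move=> n t; exact: mulr_ge0.
  - by move=> t; exact: mulr_ge0.
  - apply: ae_imp zcvg => t zt; apply: cvgM; first exact: cvg_cst.
    exact: cvg_norm.
  - by move=> n; case: (ball_z n).
exists z => //.
have mPz : measurable_fun [set: R] (Phi z) by case: (Phi_ball zb).
have zz n : (wnorm (z_ n \- z)%R <= (2 * K * 2^-1 ^+ n)%:E)%E.
  apply: (@fatou_bound (fun m t => w t * `|z_ n t - z_ (n + m) t|)) => //.
  - by move=> m; apply: measurable_wnorm; exact: measurable_funB.
  - by apply: measurable_wnorm; exact: measurable_funB.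
  - by move=> m t; rewrite mulr_ge0.
  - by move=> t; rewrite mulr_ge0.
  - apply: ae_imp zcvg => t zt; apply: cvgM; first exact: cvg_cst.
    apply: cvg_norm; apply: cvgB; first exact: cvg_cst.
    exact: (cvg_comp (addn n) (fun m => z_ m t) (cvg_addnl n) zt).
  - move=> m; under eq_integral do rewrite distrC.
    apply: le_trans (cauchy n m) _; rewrite lee_fin gerBl.
    by rewrite !mulr_ge0 ?exprn_ge0.
have bound n : (wnorm (Phi z \- z)%R <= (K * 4 * 2^-1 ^+ n)%:E)%E.
  apply: le_trans (wnorm_triangle mPz (mz n.+1) mz') _.
  apply: le_trans (leeD (Phi_contr zb (ball_z n)) (zz n.+1)) _.
  have -> : wnorm (z \- z_ n)%R = wnorm (z_ n \- z)%R.
    by apply: eq_integral => t _; rewrite /= distrC.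
  apply: le_trans (leeD2r _ (lee_wpmul2l _ (zz n))) _; first by rewrite lee_fin.
  rewrite -EFinM -EFinD lee_fin exprS.
  have : 0 <= K * 2^-1 ^+ n by rewrite mulr_ge0 ?exprn_ge0.
  lra.
have w0 : wnorm (Phi z \- z)%R = 0%E.
  apply/eqP; rewrite eq_le; apply/andP; split; last first.
    by apply: integral_ge0 => t _; rewrite lee_fin mulr_ge0.
  have cv : ((K * 4 * 2^-1 ^+ n)%:E @[n --> \oo] --> (K * 4 * 0)%:E)%E.
    apply: cvg_EFin; first exact: nearW.
    apply: cvgM; first exact: cvg_cst.
    by apply: cvg_expr; rewrite ger0_norm// invf_lt1// ltr1n.
  rewrite mulr0 in cv; rewrite [leRHS](_ : _ = 0%:E)// -(cvg_lim _ cv)//.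
  by apply: lime_ge; [apply/cvg_ex; eexists; exact: cv|exact: nearW].
have mwP : measurable_fun [set: R] (fun t => (w t * `|Phi z t - z t|)%:E).
  by apply/measurable_EFinP; apply: measurable_wnorm; exact: measurable_funB.
have /ae_eq_integral_abs : (\int[mu]_(t in setT) `|(w t * `|Phi z t - z t|)%:E| = 0)%E.
  rewrite -[RHS]w0; apply: eq_integral => t _.
  by rewrite gee0_abs// lee_fin mulr_ge0.
move=> /(_ measurableT mwP); apply: ae_imp => t /(_ I) /= [] /eqP.
by rewrite mulf_eq0 gt_eqF//= normr_eq0 subr_eq0 => /eqP.
Qed.

End weighted_fixpoint.

(** * Absolutely continuous functions *)

Section primitive.
Context {R : realType}.
Local Notation mu := (@lebesgue_measure R).
Implicit Types (z u v f : R -> R) (t : R).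

Lemma ae_neq t : {ae mu, forall s : R, s != t}.
Proof.
exists [set t]; split; [exact: measurable_set1|exact: lebesgue_measure_set1|].
by move=> s /= /negP; rewrite negbK => /eqP.
Qed.

Lemma integrable_mul_bounded (M : R) f z : measurable_fun [set: R] f ->
  (forall s, `|f s| <= M) -> mu.-integrable setT (EFin \o z) ->
  mu.-integrable setT (EFin \o (fun s => f s * z s)).
Proof.
move=> mf fM zi; have mz := integrable_measurable zi.
have Mi : mu.-integrable setT (EFin \o (fun s => M * z s)).
  have := integrableZl measurableT M zi.
  by apply: eq_integrable => // s _; rewrite /= EFinM.
apply: le_integrable Mi => //.
- by apply/measurable_EFinP; exact: measurable_funM.
- move=> s _ /=; rewrite !normrM lee_fin ler_wpM2r//.
  by rewrite (le_trans (fM s))// ler_norm.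
Qed.

Lemma heaviside_le1 t : `|heaviside t| <= 1.
Proof. by rewrite heavisideE; case: (0 < t)%R; rewrite ?normr1 ?normr0. Qed.

Lemma measurable_heaviside_sub t : measurable_fun [set: R] (fun s : R => heaviside (t - s)).
Proof. by apply: (measurableT_comp (@measurable_heaviside R)); exact: measurable_funB. Qed.

(** Indefinite integral from minus infinity, written as a convolution so that it
    obeys the same calculus as the fractional integral. *)
Definition primitive z : R -> R := conv heaviside z.

Lemma integrable_heaviside_mul z t : mu.-integrable setT (EFin \o z) ->
  mu.-integrable setT (EFin \o (fun s => heaviside (t - s) * z s)).
Proof.
move=> zi; apply: (integrable_mul_bounded (M := 1)) => //.
  exact: measurable_heaviside_sub.
by move=> s; exact: heaviside_le1.
Qed.

Lemma primitiveE z t : mu.-integrable setT (EFin \o z) ->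
  primitive z t = \int[mu]_(s in `]-oo, t]) z s.
Proof.
move=> zi; rewrite -Rintegral_itv_bndo_bndc; last exact: integrableS zi.
rewrite Rintegral_mkcond; apply: eq_Rintegral => s _.
rewrite patchE heavisideE subr_gt0.
have -> : (s \in `]-oo, t[%classic) = (s < t).
  by apply/idP/idP; rewrite inE /= in_itv.
by case: (s < t); rewrite ?mul1r ?mul0r.
Qed.

Lemma primitive_le z t (K : R) : measurable_fun [set: R] z ->
  (\int[mu]_s `|z s|%:E <= K%:E)%E -> `|primitive z t| <= K.
Proof.
move=> mz zK; rewrite -lee_fin; apply: le_trans zK.
have mh := measurable_conv_section t (@measurable_heaviside R) mz.
apply: le_trans (le_normr_Rintegral_ereal mh) _; apply: ge0_le_integral => //.
- exact: measurable_norm_EFin.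
- exact: measurable_norm_EFin.
- by move=> s _; rewrite lee_fin normrM ler_piMl// heaviside_le1.
Qed.

Lemma heaviside_cvg (t_ : nat -> R) t s : s != t -> t_ n @[n --> \oo] --> t ->
  heaviside (t_ n - s) @[n --> \oo] --> heaviside (t - s).
Proof.
move=> st tt; have [st'|ts] := ltP s t.
  apply: (@cvg_trans _ (cst (heaviside (t - s)) n @[n --> \oo])); last exact: cvg_cst.
  apply: near_eq_cvg; near=> n; rewrite /cst !heavisideE !subr_gt0 st'.
  have -> // : s < t_ n.
  by near: n; move/cvgr_gt: tt; apply.
have {}ts : t < s by rewrite lt_neqAle eq_sym st.
apply: (@cvg_trans _ (cst (heaviside (t - s)) n @[n --> \oo])); last exact: cvg_cst.
apply: near_eq_cvg; near=> n; rewrite /cst !heavisideE !subr_gt0 ltNge (ltW ts).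
rewrite (_ : (s < t_ n) = false)//; apply/negbTE; rewrite -leNgt ltW//.
by near: n; move/cvgr_lt: tt; apply.
Unshelve. all: by end_near. Qed.

(** Dominated convergence: the integrands differ only near one point. *)
Lemma primitive_continuous z : mu.-integrable setT (EFin \o z) ->
  continuous (primitive z).
Proof.
move=> zi t; have mz := integrable_measurable zi.
apply/(@cvg_nbhsP _ R^o) => t_ tt.
have mh r : measurable_fun [set: R] (fun s => (heaviside (r - s) * z s)%:E).
  by apply/measurable_EFinP; apply: measurable_conv_section => //; exact: measurable_heaviside.
have aec : {ae mu, forall s, [set: R] s ->
    (heaviside (t_ n - s) * z s)%:E @[n --> \oo] --> (heaviside (t - s) * z s)%:E}.
  apply: ae_imp (ae_neq t) => s st _; apply: cvg_EFin; first exact: nearW.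
  by apply: cvgM; [exact: heaviside_cvg|exact: cvg_cst].
have aeb : {ae mu, forall s, forall n, [set: R] s ->
    (`|(heaviside (t_ n - s) * z s)%:E| <= `|(z s)%:E|)%E}.
  apply: ae_imp (ae_neq t) => s _ n _.
  by rewrite lee_fin normrM ler_piMl// heaviside_le1.
have zi' : mu.-integrable setT (fun s => `|(z s)%:E|%E) by exact: integrable_abse.
have [_ _ H] := @dominated_convergence _ _ R mu setT measurableT
  (fun n s => (heaviside (t_ n - s) * z s)%:E) (fun s => (heaviside (t - s) * z s)%:E)
  (fun s => `|(z s)%:E|%E) (fun n => mh (t_ n)) (mh t) aec zi' aeb.
apply: fine_cvg; rewrite fineK; first exact: H.
exact: integrable_fin_num (integrable_heaviside_mul t zi).
Qed.

(** Lebesgue's differentiation theorem. *)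
Lemma primitive_FTC z : mu.-integrable setT (EFin \o z) ->
  {ae mu, forall t, derivable (primitive z) t 1 /\ derive1 (primitive z) t = z t}.
Proof.
move=> zi; have mz := integrable_measurable zi.
have zi' y : mu.-integrable `]-oo, y] (EFin \o z) by exact: integrableS zi.
have -> : primitive z = (fun t => \int[mu]_(s in `]-oo, t]) z s).
  by apply/funext => t; exact: primitiveE.
apply: FTC1Ny => //; split => //; first exact: openT.
move=> K _ cK; have /integrableP[_] : mu.-integrable K (EFin \o z).
  by apply: integrableS zi => //; exact: compact_measurable.
by under eq_integral do rewrite /=.
Qed.

Lemma integrable_mul_primitive u v : mu.-integrable setT (EFin \o u) ->
  mu.-integrable setT (EFin \o v) ->
  mu.-integrable setT (EFin \o (fun s => u s * primitive v s)).
Proof.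
move=> ui vi; have mv := integrable_measurable vi.
have -> : (fun s => u s * primitive v s) = (fun s => primitive v s * u s).
  by apply/funext => s; rewrite mulrC.
have vfin : (\int[mu]_s `|v s|%:E \is a fin_num)%E.
  rewrite ge0_fin_numE; last exact: integral_ge0.
  by case/integrableP : vi.
apply: (integrable_mul_bounded (M := fine (\int[mu]_s `|v s|%:E)%E)) => //.
- by apply: continuous_measurable_fun; exact: primitive_continuous.
- by move=> s; apply: primitive_le => //; rewrite fineK.
Qed.

Lemma Rintegral_fubini (F : R * R -> R) :
  (mu \x mu)%E.-integrable [set: R * R] (fun p => (F p)%:E) ->
  \int[mu]_s \int[mu]_r F (s, r) = \int[mu]_r \int[mu]_s F (s, r).
Proof.
move=> Fi; rewrite [LHS]/Rintegral [RHS]/Rintegral; congr fine.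
have mF : measurable_fun setT (fun s => \int[mu]_r (F (s, r))%:E)%E.
  exact: measurable_fubini_F Fi.
have mG : measurable_fun setT (fun r => \int[mu]_s (F (s, r))%:E)%E.
  exact: measurable_fubini_G Fi.
transitivity (\int[mu]_s \int[mu]_r (F (s, r))%:E)%E.
  apply: ae_eq_integral => //.
    by apply/measurable_EFinP; exact: measurableT_comp.
  apply: ae_imp (ae_integrable1 Fi) => s Fs _.
  by rewrite /Rintegral fineK//; exact: integrable_fin_num Fs.
rewrite (Fubini Fi); apply/esym/ae_eq_integral => //.
  by apply/measurable_EFinP; exact: measurableT_comp.
apply: ae_imp (ae_integrable2 Fi) => s Fs _.
by rewrite /Rintegral fineK//; exact: integrable_fin_num Fs.
Qed.

Lemma integrable_heaviside_prod u v : mu.-integrable setT (EFin \o u) ->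
  mu.-integrable setT (EFin \o v) ->
  (mu \x mu)%E.-integrable [set: R * R]
    (fun p : R * R => (heaviside (p.2 - p.1) * (u p.1 * v p.2))%:E).
Proof.
move=> ui vi; have [mu' mv] := (integrable_measurable ui, integrable_measurable vi).
case/integrableP : (ui) => _ ul; case/integrableP : (vi) => _ vl.
have mF : measurable_fun [set: R * R]
    (fun p : R * R => heaviside (p.2 - p.1) * (u p.1 * v p.2)).
  apply: measurable_funM.
    apply: (measurableT_comp (@measurable_heaviside R)); exact: measurable_funB.
  by apply: measurable_funM; exact: measurableT_comp.
apply/integrable12ltyP; first exact/measurable_EFinP.
apply: (@le_lt_trans _ _ (\int[mu]_s (`|u s|%:E * \int[mu]_r `|v r|%:E))%E); last first.
  rewrite ge0_integralZr//; [|exact: measurable_norm_EFin|exact: integral_ge0].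
  rewrite lte_mul_pinfty//; first exact: integral_ge0.
  by rewrite ge0_fin_numE// integral_ge0.
have mnF := measurable_norm_EFin mF.
apply: ge0_le_integral => //.
- by move=> s _; exact: integral_ge0.
- exact: (@measurable_fun_fubini_tonelli_F _ _ _ _ R mu _ mnF (fun=> normr_ge0 _)).
- by apply: emeasurable_funM => //; exact: measurable_norm_EFin.
- move=> s _; rewrite -ge0_integralZl//; last exact: measurable_norm_EFin.
  apply: ge0_le_integral => //.
  + apply: measurable_norm_EFin; exact: (measurableT_comp mF).
  + by apply: measurable_funeM; exact: measurable_norm_EFin.
  + by move=> r _; rewrite /= -EFinM lee_fin -normrM [leLHS]normrM ler_piMl// heaviside_le1.
Qed.

(** Integration by parts for absolutely continuous functions: the product of two
    integrals is an integral over a square, which the diagonal cuts into two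
    triangles. *)
Lemma Rintegral_primitive_mul u v t : mu.-integrable setT (EFin \o u) ->
  mu.-integrable setT (EFin \o v) ->
  primitive u t * primitive v t =
  primitive (fun s => u s * primitive v s + v s * primitive u s) t.
Proof.
move=> ui vi; have [mu' mv] := (integrable_measurable ui, integrable_measurable vi).
pose U s := heaviside (t - s) * u s; pose V s := heaviside (t - s) * v s.
have Ui : mu.-integrable setT (EFin \o U) by exact: integrable_heaviside_mul.
have Vi : mu.-integrable setT (EFin \o V) by exact: integrable_heaviside_mul.
(* Cutting u and v at t changes nothing before t and makes both sides
   integrals over the whole plane. *)
have E1 s : U s * primitive v s = U s * primitive V s.
  rewrite /U heavisideE subr_gt0; have [st|_] := ltP s t; last by rewrite !mul0r.
  rewrite !mul1r; congr (_ * _); apply: eq_Rintegral => r _.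
  rewrite /V !heavisideE !subr_gt0; have [rs|_] := ltP r s; last by rewrite !mul0r.
  by rewrite (lt_trans rs st) !mul1r.
have E2 s : V s * primitive u s = V s * primitive U s.
  rewrite /V heavisideE subr_gt0; have [st|_] := ltP s t; last by rewrite !mul0r.
  rewrite !mul1r; congr (_ * _); apply: eq_Rintegral => r _.
  rewrite /U !heavisideE !subr_gt0; have [rs|_] := ltP r s; last by rewrite !mul0r.
  by rewrite (lt_trans rs st) !mul1r.
transitivity (\int[mu]_s (U s * primitive V s + V s * primitive U s)); last first.
  apply: eq_Rintegral => s _; rewrite -E1 -E2 /U /V; ring.
rewrite RintegralD//; [|exact: integrable_mul_primitive|exact: integrable_mul_primitive].
have Vsec s : mu.-integrable setT (EFin \o (fun r => heaviside (r - s) * (U s * V r))).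
  have := integrableZl measurableT (U s) (integrable_mul_bounded (M := 1) 
    (f := fun r => heaviside (r - s)) _ (fun r => heaviside_le1 _) Vi).
  have mh : measurable_fun [set: R] (fun r : R => heaviside (r - s)).
    by apply: (measurableT_comp (@measurable_heaviside R)); exact: measurable_funB.
  by move=> /(_ mh); apply: eq_integrable => // r _; rewrite -EFinM mulrCA.
have -> : \int[mu]_s (V s * primitive U s) =
    \int[mu]_s \int[mu]_r (heaviside (r - s) * (U s * V r)).
  rewrite (Rintegral_fubini (integrable_heaviside_prod Ui Vi)) /=.
  apply: eq_Rintegral => r _.
  rewrite /primitive /conv -RintegralZl//; last exact: integrable_heaviside_mul.
  by apply: eq_Rintegral => s _; ring.
have Ui2 := integrable_fubini_F (integrable_heaviside_prod Ui Vi).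
rewrite -RintegralD//; last 2 first.
- exact: integrable_mul_primitive.
- move: Ui2; apply: eq_integrable => // s _ /=.
  rewrite /Rintegral fineK//; exact: integrable_fin_num (Vsec s).
have -> : primitive u t * primitive v t = \int[mu]_s (U s * \int[mu]_r V r).
  by rewrite RintegralZr.
apply: eq_Rintegral => s _.
have -> : U s * primitive V s = \int[mu]_r (U s * (heaviside (s - r) * V r)).
  by rewrite RintegralZl//; exact: integrable_heaviside_mul.
rewrite -RintegralD//; last first.
  have := integrableZl measurableT (U s) (integrable_heaviside_mul s Vi).
  by apply: eq_integrable => // r _; rewrite -EFinM.
rewrite -RintegralZl//; rewrite /Rintegral; congr fine.
apply: ae_eq_integral => //.
- by case/integrableP : (integrableZl measurableT (U s) Vi).
- apply/measurable_EFinP; apply: measurable_funD.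
    apply: measurable_funM => //; exact: (integrable_measurable (integrable_heaviside_mul s Vi)).
  exact: (integrable_measurable (Vsec s)).
(* Away from the diagonal exactly one of s < r and r < s holds. *)
apply: ae_imp (ae_neq s) => r rs _; congr EFin; rewrite -/(V r) !heavisideE !subr_gt0.
by move: rs; rewrite neq_lt => /orP[rs|sr]; rewrite ?rs ?sr ltNge ?(ltW rs) ?(ltW sr) /= !mul1r ?mul0r; ring.
Qed.

End primitive.

(** * The integral equation for the derivative *)

Section weighted_estimates.
Context {R : realType}.
Local Notation mu := (@lebesgue_measure R).
Implicit Types (f u : R -> R) (lam t : R).

Lemma ew_ge0 lam t : 0 <= ew lam t. Proof. exact/ltW/ew_gt0. Qed.

Lemma ew_le lam t r : 0 <= lam -> r <= t -> ew lam t <= ew lam r.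
Proof. by move=> l0 rt; rewrite /ew ler_expR !mulNr lerN2 ler_wpM2l. Qed.

(** Young's inequality; the weight is multiplicative, so it splits between the two
    factors. *)
Lemma wnorm_conv lam f u : measurable_fun [set: R] f -> measurable_fun [set: R] u ->
  (wnorm (ew lam) (conv f u) <= wnorm (ew lam) f * wnorm (ew lam) u)%E.
Proof.
move=> mf mu'.
have mef : measurable_fun [set: R] (fun t => ew lam t * f t).
  by apply: measurable_funM => //; exact: measurable_ew.
have meu : measurable_fun [set: R] (fun t => ew lam t * u t).
  by apply: measurable_funM => //; exact: measurable_ew.
have -> : wnorm (ew lam) f = (\int[mu]_t `|ew lam t * f t|%:E)%E.
  by apply: eq_integral => t _; rewrite normrM ger0_norm// ew_ge0.
have -> : wnorm (ew lam) u = (\int[mu]_t `|ew lam t * u t|%:E)%E.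
  by apply: eq_integral => t _; rewrite normrM ger0_norm// ew_ge0.
rewrite -tonelli_conv//; apply: ge0_le_integral => //.
- by move=> t _; rewrite lee_fin mulr_ge0// ew_ge0.
- apply/measurable_EFinP/measurable_funM; first exact: measurable_ew.
  by apply: measurableT_comp => //; exact: measurable_conv.
- have mnF := measurable_norm_EFin (measurable_conv_kernel mef meu).
  exact: (@measurable_fun_fubini_tonelli_F _ _ _ _ R mu _ mnF (fun=> normr_ge0 _)).
- move=> t _; rewrite EFinM.
  have ms := measurable_conv_section t mf mu'.
  apply: (@le_trans _ _ ((ew lam t)%:E * \int[mu]_s `|f (t - s) * u s|%:E)%E).
    by apply: lee_wpmul2l; [rewrite lee_fin ew_ge0|exact: le_normr_Rintegral_ereal].
  rewrite -ge0_integralZl//; [|exact: measurable_norm_EFin|by rewrite lee_fin ew_ge0].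
  rewrite le_eqVlt; apply/orP; left; apply/eqP; apply: eq_integral => s _.
  have e0 : 0 <= ew lam (t - s) * ew lam s by rewrite mulr_ge0// ew_ge0.
  by rewrite -EFinM (ewB lam t s) mulrACA [in RHS]normrM (ger0_norm e0).
Qed.

(** A positive delay can only decrease the weighted norm. *)
Lemma wnorm_shift lam (tau : R) u : 0 <= lam -> 0 <= tau -> measurable_fun [set: R] u ->
  (wnorm (ew lam) (fun t => u (t - tau)%R) <= wnorm (ew lam) u)%E.
Proof.
move=> l0 tau0 mu'.
have mw : measurable_fun [set: R] (fun t => (ew lam t * `|u t|)%:E).
  apply/measurable_EFinP/measurable_funM; first exact: measurable_ew.
  exact: measurableT_comp.
have mus : measurable_fun [set: R] (fun t => u (t - tau)%R).
  by apply: (measurableT_comp mu'); exact: measurable_funB.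
rewrite /wnorm -[leRHS](@integral_isometry R 1 (- tau) _ (normr1 _) mw).
apply: ge0_le_integral => //.
- by move=> t _; rewrite lee_fin mulr_ge0// ew_ge0.
- apply/measurable_EFinP/measurable_funM; first exact: measurable_ew.
  exact: measurableT_comp.
- by apply: (measurableT_comp mw); exact: measurable_affine.
- move=> t _; rewrite mul1r lee_fin ler_wpM2r// ew_le//.
  by rewrite gerBl.
Qed.

(** The norm lam `^ (- al) of the kernel in the weight e^(-lam t) is as small as
    desired: this is what makes the Volterra operator contracting on any interval. *)
Lemma powR_small al (e : R) : 0 < al -> 0 < e ->
  exists2 l0 : R, 0 < l0 & forall lam, l0 <= lam -> lam `^ (- al) <= e.
Proof.
move=> al0 e0; exists (e `^ (- al^-1)); first exact: powR_gt0.
move=> lam le; have lam0 : 0 < lam by apply: lt_le_trans le; exact: powR_gt0.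
rewrite powRN -[leRHS]invrK lef_pV2 ?posrE ?powR_gt0 ?invr_gt0//.
have -> : e^-1 = (e `^ (- al^-1)) `^ al.
  by rewrite -powRrM mulNr mulVf ?gt_eqF// powR_inv1 ?ltW.
by apply: ge0_ler_powR => //; rewrite ?nnegrE ?powR_ge0 ?ltW.
Qed.

Lemma primitiveB u f t : mu.-integrable setT (EFin \o u) ->
  mu.-integrable setT (EFin \o f) ->
  primitive (u \- f) t = primitive u t - primitive f t.
Proof.
move=> ui fi; rewrite /primitive /conv -RintegralB//; [|exact: integrable_heaviside_mul..].
by apply: eq_Rintegral => s _; rewrite /= mulrBr.
Qed.

(** The weighted L1 norm of a density controls the weighted supremum of its
    primitive. *)
Lemma ew_primitive_le lam u t : 0 <= lam -> measurable_fun [set: R] u ->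
  ((ew lam t * `|primitive u t|)%:E <= wnorm (ew lam) u)%E.
Proof.
move=> l0 mu'; have mh := measurable_conv_section t (@measurable_heaviside R) mu'.
rewrite EFinM; apply: (@le_trans _ _ ((ew lam t)%:E * \int[mu]_s `|heaviside (t - s) * u s|%:E)%E).
  by apply: lee_wpmul2l; [rewrite lee_fin ew_ge0|exact: le_normr_Rintegral_ereal].
rewrite -ge0_integralZl//; [|exact: measurable_norm_EFin|by rewrite lee_fin ew_ge0].
apply: ge0_le_integral => //.
- by move=> s _; rewrite -EFinM lee_fin mulr_ge0// ew_ge0.
- by apply: measurable_funeM; exact: measurable_norm_EFin.
- apply/measurable_EFinP/measurable_funM; first exact: measurable_ew.
  exact: measurableT_comp.
- move=> s _; rewrite -EFinM lee_fin heavisideE subr_gt0.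
  have [st|_] := ltP s t; last by rewrite mul0r normr0 mulr0 mulr_ge0// ew_ge0.
  by rewrite mul1r ler_wpM2r// ew_le// ltW.
Qed.

End weighted_estimates.

Section delay_fixpoint.
Context {R : realType}.
Local Notation mu := (@lebesgue_measure R).
Variables (al T tau y0 F0 C L : R) (A B : R -> R).
Hypotheses (al_gt0 : 0 < al) (al_le1 : al <= 1).
Hypotheses (tau_ge0 : 0 <= tau) (C_ge0 : 0 <= C) (L_ge0 : 0 <= L).
Hypotheses (cA : continuous A) (cB : continuous B).
Hypotheses (AC : forall u, `|A u| <= C) (BC : forall u, `|B u| <= C).
Hypotheses (AL : forall u v, `|A u - A v| <= L * `|u - v|)
           (BL : forall u v, `|B u - B v| <= L * `|u - v|).

Local Notation k := (fkern al).

(** The unknown is the derivative z rather than the solution itself; y0 is the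
    constant history. *)
Definition state (z : R -> R) (t : R) : R := y0 + primitive z t.

(** The derivative of t |-> g (y t) (y (t - tau)) along the state y, if A and B are
    the partial derivatives of g, here functions of one variable each. *)
Definition delay_field (z : R -> R) (s : R) : R :=
  A (state z s) * z s + B (state z (s - tau)) * z (s - tau).

(** The Volterra equation y = y0 + k convolved with g (y, y_tau), differentiated in
    time: F0 = g (y0, y0) is the initial jump of the forcing, whence the singular
    term F0 k. *)
Definition delay_map (z : R -> R) (s : R) : R :=
  \1_(`]0, T[%classic : set R) s * (F0 * k s + conv k (delay_field z) s).

Let mk : measurable_fun [set: R] k := @measurable_fkern R al.

Let wk lam : 0 < lam -> wnorm (ew lam) k = (lam `^ (- al))%:E.
Proof.
move=> l0; rewrite -laplace_fkern//; apply: eq_integral => t _.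
by rewrite ger0_norm// fkern_ge0.
Qed.

Let state_continuous z : mu.-integrable setT (EFin \o z) -> continuous (state z).
Proof.
by move=> zi t; apply: cvgD; [exact: cvg_cst|exact: primitive_continuous].
Qed.

Lemma measurable_shift (u : R -> R) : measurable_fun [set: R] u ->
  measurable_fun [set: R] (fun t => u (t - tau)%R).
Proof. by move=> mu'; apply: (measurableT_comp mu'); exact: measurable_funB. Qed.

Lemma measurable_delay_field z : mu.-integrable setT (EFin \o z) ->
  measurable_fun [set: R] (delay_field z).
Proof.
move=> zi; have mz := integrable_measurable zi.
have mX : measurable_fun [set: R] (state z).
  exact: (continuous_measurable_fun (state_continuous zi)).
have mA := continuous_measurable_fun cA; have mB := continuous_measurable_fun cB.
apply: measurable_funD; apply: measurable_funM => //.
- exact: (measurableT_comp mA).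
- exact: (measurableT_comp mB (measurable_shift mX)).
- exact: measurable_shift.
Qed.

Lemma delay_field_le z s : `|delay_field z s| <= C * (`|z s| + `|z (s - tau)|).
Proof.
rewrite (le_trans (ler_normD _ _))// mulrDr !normrM lerD// ler_wpM2r//.
Qed.

Lemma wnorm_delay_field lam z : 0 <= lam -> mu.-integrable setT (EFin \o z) ->
  (wnorm (ew lam) (delay_field z) <= (2 * C)%:E * wnorm (ew lam) z)%E.
Proof.
move=> l0 zi; have mz := integrable_measurable zi.
have m1 (u : R -> R) : measurable_fun [set: R] u ->
    measurable_fun [set: R] (fun t => (ew lam t * `|u t|)%:E).
  move=> mu'; apply/measurable_EFinP/measurable_funM; first exact: measurable_ew.
  exact: measurableT_comp.
have p (u : R -> R) t : (0 <= (ew lam t * `|u t|)%:E)%E by rewrite lee_fin mulr_ge0// ew_ge0.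
have mzs := measurable_shift mz.
apply: (@le_trans _ _ (C%:E * (wnorm (ew lam) z + wnorm (ew lam) (fun t => z (t - tau)%R)))%E).
  rewrite /wnorm -ge0_integralD//; try first
    [exact: m1|exact: (m1 (fun t => z (t - tau)%R))|by move=> t _; exact: p
    |by move=> t _; exact: (p (fun t => z (t - tau)%R))].
  rewrite -ge0_integralZl//; last 2 first.
  - by apply: emeasurable_funD; [exact: m1|exact: (m1 (fun t => z (t - tau)%R))].
  - by move=> t _; apply: adde_ge0; [exact: p|exact: (p (fun t => z (t - tau)%R))].
  apply: ge0_le_integral => //.
  - exact: (m1 _ (measurable_delay_field zi)).
  - apply: measurable_funeM.
    by apply: emeasurable_funD; [exact: m1|exact: (m1 (fun t => z (t - tau)%R))].
  - move=> t _; rewrite -EFinD -EFinM lee_fin -mulrDr mulrCA ler_wpM2l ?ew_ge0//.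
    exact: delay_field_le.
have -> : (2 * C)%:E = (C%:E * 2%:E)%E by rewrite -EFinM mulrC.
rewrite -muleA; apply: lee_wpmul2l; first by rewrite lee_fin.
apply: le_trans (leeD2l _ (wnorm_shift l0 tau_ge0 mz)) _.
by rewrite -mule2n -mule_natl.
Qed.

(** The coefficients A and B contribute the last term: their variation is controlled
    by the difference of the states up to time s, hence by N. *)
Lemma delay_field_diff lam z z' (N : R) s : 0 <= lam ->
  mu.-integrable setT (EFin \o z) -> mu.-integrable setT (EFin \o z') ->
  (wnorm (ew lam) (z \- z')%R <= N%:E)%E ->
  ew lam s * `|delay_field z s - delay_field z' s| <=
  C * (ew lam s * `|(z \- z') s|) + C * (ew lam s * `|(z \- z') (s - tau)|) +
  L * N * (`|z' s| + `|z' (s - tau)|).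
Proof.
move=> l0 zi zi' zN.
have md : measurable_fun [set: R] (z \- z').
  by apply: measurable_funB; exact: integrable_measurable.
have D r : r <= s -> ew lam s * `|state z r - state z' r| <= N.
  move=> rs; have -> : state z r - state z' r = primitive (z \- z') r.
    by rewrite primitiveB// /state; ring.
  rewrite -lee_fin; apply: le_trans zN; apply: le_trans (ew_primitive_le r l0 md).
  by rewrite lee_fin ler_wpM2r// ew_le.
have DA r : r <= s -> ew lam s * `|A (state z r) - A (state z' r)| <= L * N.
  move=> rs; apply: (@le_trans _ _ (ew lam s * (L * `|state z r - state z' r|))).
    by rewrite ler_wpM2l ?ew_ge0.
  by rewrite mulrCA ler_wpM2l// D.
have DB r : r <= s -> ew lam s * `|B (state z r) - B (state z' r)| <= L * N.
  move=> rs; apply: (@le_trans _ _ (ew lam s * (L * `|state z r - state z' r|))).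
    by rewrite ler_wpM2l ?ew_ge0.
  by rewrite mulrCA ler_wpM2l// D.
have stau : s - tau <= s by rewrite gerBl.
set a := A (state z s); set a' := A (state z' s).
set b := B (state z (s - tau)); set b' := B (state z' (s - tau)).
have -> : delay_field z s - delay_field z' s =
   (a * (z \- z') s + b * (z \- z') (s - tau)) + ((a - a') * z' s + (b - b') * z' (s - tau)).
  by rewrite /delay_field -/a -/a' -/b -/b' /=; ring.
have e0 := ew_ge0 lam s.
apply: (@le_trans _ _ (ew lam s * ((`|a| * `|(z \- z') s| + `|b| * `|(z \- z') (s - tau)|) +
   (`|a - a'| * `|z' s| + `|b - b'| * `|z' (s - tau)|)))).
  rewrite ler_wpM2l// (le_trans (ler_normD _ _))// lerD// (le_trans (ler_normD _ _))//;
  by rewrite !normrM.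
rewrite mulrDr; apply: lerD.
  by rewrite mulrDr lerD// mulrCA ler_wpM2r ?mulr_ge0// ?AC ?BC.
rewrite mulrDr mulrDr lerD// mulrA ler_wpM2r//; [exact: DA|exact: DB].
Qed.

Lemma wnorm_delay_field_diff lam z z' (M : R) : 0 <= lam ->
  mu.-integrable setT (EFin \o z) -> mu.-integrable setT (EFin \o z') ->
  (wnorm (ew lam) (z \- z')%R < +oo)%E -> (\int[mu]_s `|z' s|%:E <= M%:E)%E ->
  (wnorm (ew lam) (delay_field z \- delay_field z')%R <=
   (2 * C + 2 * L * M)%:E * wnorm (ew lam) (z \- z')%R)%E.
Proof.
move=> l0 zi zi' zfin z'M.
have [mz mz'] := (integrable_measurable zi, integrable_measurable zi').
pose d := z \- z'; have md : measurable_fun [set: R] d by exact: measurable_funB.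
have m1 (u : R -> R) : measurable_fun [set: R] u ->
    measurable_fun [set: R] (fun t => (ew lam t * `|u t|)%:E).
  move=> mu'; apply/measurable_EFinP/measurable_funM; first exact: measurable_ew.
  exact: measurableT_comp.
have p (u : R -> R) t : (0 <= (ew lam t * `|u t|)%:E)%E by rewrite lee_fin mulr_ge0// ew_ge0.
have Nfin : wnorm (ew lam) d \is a fin_num.
  by rewrite ge0_fin_numE//; apply: integral_ge0 => t _; exact: p.
pose N := fine (wnorm (ew lam) d); have NE : N%:E = wnorm (ew lam) d by rewrite /N fineK.
have N0 : 0 <= N by apply: fine_ge0; apply: integral_ge0 => t _; exact: p.
pose f1 t := (ew lam t * `|d t|)%:E; pose f2 t := (ew lam t * `|d (t - tau)|)%:E.
pose f3 (t : R) : \bar R := `|z' t|%:E; pose f4 (t : R) : \bar R := `|z' (t - tau)|%:E.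
have mf1 : measurable_fun [set: R] f1 by exact: m1.
have mf2 : measurable_fun [set: R] f2 by apply: (m1 (fun t => d (t - tau))); exact: measurable_shift.
have mf3 : measurable_fun [set: R] f3 by exact: measurable_norm_EFin.
have mf4 : measurable_fun [set: R] f4.
  by apply: (@measurable_norm_EFin R _ _ (fun t : R => z' (t - tau))); exact: measurable_shift.
have f10 t : (0 <= f1 t)%E by exact: p.
have f20 t : (0 <= f2 t)%E by exact: (p (fun t => d (t - tau))).
have f30 t : (0 <= f3 t)%E by rewrite lee_fin.
have f40 t : (0 <= f4 t)%E by rewrite lee_fin.
have LN0 : 0 <= L * N by exact: mulr_ge0.
have step : (wnorm (ew lam) (delay_field z \- delay_field z')%R <=
   \int[mu]_t (C%:E * f1 t + C%:E * f2 t + (L * N)%:E * (f3 t + f4 t)))%E.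
  apply: ge0_le_integral => //.
  - by apply: (m1 _ (measurable_funB _ _)); exact: measurable_delay_field.
  - apply: emeasurable_funD; last by apply: measurable_funeM; exact: emeasurable_funD.
    by apply: emeasurable_funD; exact: measurable_funeM.
  - move=> t _; rewrite /f1 /f2 /f3 /f4 -!EFinD lee_fin.
    by apply: delay_field_diff => //; rewrite NE.
apply: le_trans step _.
rewrite ge0_integralD//; last 4 first.
- by move=> t _; rewrite adde_ge0// mule_ge0.
- by apply: emeasurable_funD; exact: measurable_funeM.
- by move=> t _; apply: mule_ge0; [rewrite lee_fin|exact: adde_ge0].
- by apply: measurable_funeM; exact: emeasurable_funD.
rewrite ge0_integralD//; last 4 first.
- by move=> t _; rewrite mule_ge0.
- exact: measurable_funeM.
- by move=> t _; rewrite mule_ge0.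
- exact: measurable_funeM.
rewrite !ge0_integralZl//; last 2 first.
- exact: emeasurable_funD.
- by move=> t _; rewrite adde_ge0.
rewrite ge0_integralD//.
have -> : (\int[mu]_t f1 t = N%:E)%E by rewrite NE.
have f2N : (\int[mu]_t f2 t <= N%:E)%E by rewrite NE; exact: wnorm_shift.
have -> : (\int[mu]_t f4 t = \int[mu]_t f3 t)%E.
  rewrite -[RHS](@integral_isometry R 1 (- tau) _ (normr1 _) mf3).
  by apply: eq_integral => t _; rewrite mul1r.
rewrite -/d -NE.
apply: (@le_trans _ _ (C%:E * N%:E + C%:E * N%:E + (L * N)%:E * (M%:E + M%:E))%E).
  apply: leeD; first by apply: leeD => //; exact: lee_wpmul2l.
  by apply: lee_wpmul2l; [rewrite lee_fin|exact: leeD].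
have E : C * N + C * N + L * N * (M + M) = (2 * C + 2 * L * M) * N by ring.
by move: (lexx ((2 * C + 2 * L * M) * N)); rewrite -{1}E -lee_fin.
Qed.

Definition in_ball (l0 K : R) := supp_ball `]0%R, T[%classic (ew l0) K.

Lemma in_ball_bound l0 K z : 0 <= l0 -> in_ball l0 K z ->
  (\int[mu]_s `|z s|%:E <= (expR (l0 * T) * K)%:E)%E.
Proof.
move=> l00 [mz z0 zK].
have mw : measurable_fun [set: R] (fun t => (ew l0 t * `|z t|)%:E).
  apply/measurable_EFinP/measurable_funM; first exact: measurable_ew.
  exact: measurableT_comp.
apply: (@le_trans _ _ ((expR (l0 * T))%:E * \int[mu]_t (ew l0 t * `|z t|)%:E)%E); last first.
  by rewrite EFinM; apply: lee_wpmul2l => //; rewrite lee_fin expR_ge0.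
rewrite -ge0_integralZl//; last first.
  by move=> t _; rewrite lee_fin mulr_ge0// ew_ge0.
apply: ge0_le_integral => //.
- exact: measurable_norm_EFin.
- exact: measurable_funeM.
- move=> t _; rewrite -EFinM lee_fin.
  have [|/z0 ->] := pselect (`]0%R, T[%classic t); last by rewrite normr0 !mulr0.
  rewrite /= in_itv /= => /andP[t0 tT]; rewrite mulrA ler_peMl// /ew -expRD.
  by rewrite -expR0 ler_expR mulNr -mulrBr mulr_ge0// subr_ge0 ltW.
Qed.

Lemma in_ball_integrable l0 K z : 0 <= l0 -> in_ball l0 K z ->
  mu.-integrable setT (EFin \o z).
Proof.
move=> l00 zb; have [mz _ _] := zb; apply/integrableP; split; first exact/measurable_EFinP.
by apply: le_lt_trans (in_ball_bound l00 zb) _; rewrite ltry.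
Qed.

Lemma wnorm_supp_lty lam z : 0 <= lam -> mu.-integrable setT (EFin \o z) ->
  (forall t, ~ `]0, T[%classic t -> z t = 0) -> (wnorm (ew lam) z < +oo)%E.
Proof.
move=> lam0 zi z0; have mz := integrable_measurable zi.
apply: (@le_lt_trans _ _ (\int[mu]_s `|z s|%:E)%E); last by case/integrableP : zi.
apply: ge0_le_integral => //.
- by move=> t _; rewrite lee_fin mulr_ge0// ew_ge0.
- apply/measurable_EFinP/measurable_funM; first exact: measurable_ew.
  exact: measurableT_comp.
- exact: measurable_norm_EFin.
- move=> t _; rewrite lee_fin.
  have [|/z0 ->] := pselect (`]0%R, T[%classic t); last by rewrite normr0 !mulr0.
  rewrite /= in_itv /= => /andP[t0 tT]; rewrite ler_piMl//.
  by rewrite /ew -[leRHS]expR0 ler_expR mulNr oppr_le0 mulr_ge0// ltW.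
Qed.

Lemma ew_delay_field_integrable lam l0 K z : 0 <= lam -> 0 <= l0 -> in_ball l0 K z ->
  mu.-integrable setT (EFin \o (fun s => ew lam s * delay_field z s)).
Proof.
move=> lam0 l00 zb; have zi := in_ball_integrable l00 zb; have [mz z0 _] := zb.
have mH := measurable_delay_field zi.
apply/integrableP; split.
  by apply/measurable_EFinP/measurable_funM => //; exact: measurable_ew.
apply: (@le_lt_trans _ _ (wnorm (ew lam) (delay_field z))).
  apply: ge0_le_integral => //.
  - apply: measurable_norm_EFin; apply: measurable_funM => //; exact: measurable_ew.
  - apply/measurable_EFinP/measurable_funM; first exact: measurable_ew.
    exact: measurableT_comp.
  - by move=> s _; rewrite /= lee_fin normrM (ger0_norm (ew_ge0 _ _)).
apply: le_lt_trans (wnorm_delay_field lam0 zi) _.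
rewrite lte_mul_pinfty//; first by rewrite lee_fin mulr_ge0.
exact: wnorm_supp_lty.
Qed.

Lemma ew_fkern_integrable lam : 0 < lam ->
  mu.-integrable setT (EFin \o (fun s => ew lam s * k s)).
Proof.
move=> l0; apply/integrableP; split.
  by apply/measurable_EFinP/measurable_funM => //; exact: measurable_ew.
apply: le_lt_trans (ltry (lam `^ (- al))); rewrite -laplace_fkern//.
rewrite le_eqVlt; apply/orP; left; apply/eqP; apply: eq_integral => s _.
by rewrite /= ger0_norm// mulr_ge0 ?ew_ge0// fkern_ge0.
Qed.

Lemma ae_conv_integrable l0 K z : 0 <= l0 -> in_ball l0 K z ->
  {ae mu, forall t, mu.-integrable setT (EFin \o (fun s => k (t - s) * delay_field z s))}.
Proof.
move=> l00 zb.
have Ki := integrable_conv_kernel (ew_fkern_integrable ltr01)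
  (ew_delay_field_integrable ler01 l00 zb).
apply: ae_imp (ae_integrable1 Ki) => t it.
have := integrableZl measurableT (ew 1 t)^-1 it.
apply: eq_integrable => // s _; rewrite /= -EFinM; congr EFin.
by rewrite (ewB 1 t s) mulrACA mulKf// mulf_neq0// gt_eqF// ew_gt0.
Qed.

Lemma measurable_delay_map z : mu.-integrable setT (EFin \o z) ->
  measurable_fun [set: R] (delay_map z).
Proof.
move=> zi; apply: measurable_funM; first exact: measurable_indic.
apply: measurable_funD; first exact: measurable_funM.
by apply: measurable_conv => //; exact: measurable_delay_field.
Qed.

(** Existence of a density z on ]0, T[ for an arbitrary horizon T. The coefficients
    are bounded and Lipschitz, so the map preserves a ball for one exponential
    weight and is a contraction on it for a larger one. *)
Lemma delay_map_fixpoint : exists z : R -> R,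
  [/\ mu.-integrable setT (EFin \o z),
      forall t, ~ `]0, T[%classic t -> z t = 0 &
      {ae mu, forall t, z t = delay_map z t}].
Proof.
(* With this bound on l0 `^ (- al) the linear growth 2 C of the field costs
   at most half of the radius K, so the ball of radius K is stable. *)
have C1 : 0 < (4 * (C + 1))^-1 by rewrite invr_gt0 mulr_gt0// ltr_wpDl.
have [l0 l00 l0P] := powR_small al_gt0 C1.
pose K := 2 * `|F0| * l0 `^ (- al).
have K0 : 0 <= K by rewrite !mulr_ge0// powR_ge0.
pose M := expR (l0 * T) * K.
have M0 : 0 <= M by rewrite mulr_ge0// expR_ge0.
(* M bounds the unweighted L1 norm on the ball; it enters the Lipschitz
   constant, hence the second, larger exponent lam. *)
have C2 : 0 < (4 * (C + L * M + 1))^-1.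
  by rewrite invr_gt0 mulr_gt0// ltr_wpDl// addr_ge0// mulr_ge0.
have [l1 l10 l1P] := powR_small al_gt0 C2.
pose lam := Num.max l0 l1.
have lam0 : 0 < lam by rewrite lt_max l00.
have m1 lam' (u : R -> R) : measurable_fun [set: R] u ->
    measurable_fun [set: R] (fun t => (ew lam' t * `|u t|)%:E).
  move=> mu'; apply/measurable_EFinP/measurable_funM; first exact: measurable_ew.
  exact: measurableT_comp.
have p lam' (u : R -> R) t : (0 <= (ew lam' t * `|u t|)%:E)%E by rewrite lee_fin mulr_ge0// ew_ge0.
have [z zb zfix] : exists2 z, in_ball l0 K z & {ae mu, forall t, delay_map z t = z t}.
  apply: (@weighted_fixpoint R _ (ew lam)) => //.
  - exact: measurable_ew.
  - exact: ew_gt0.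
  - exact: measurable_ew.
  - exact: ew_ge0.
  - move=> t; rewrite /= in_itv /= => /andP[t0 _]; rewrite /ew ler_expR !mulNr lerN2.
    by rewrite ler_wpM2r ?(ltW t0)// le_max lexx.
  - move=> z zb; have zi := in_ball_integrable (ltW l00) zb; have [mz z0 zK] := zb.
    split; first exact: measurable_delay_map.
      by move=> t nt; rewrite /delay_map indicE memNset// mul0r.
    have mH := measurable_delay_field zi.
    have mc := measurable_conv mk mH.
    apply: (@le_trans _ _ (`|F0|%:E * wnorm (ew l0) k + wnorm (ew l0) (conv k (delay_field z)))%E).
      rewrite /wnorm -ge0_integralZl//; try first [exact: m1|by move=> t _; exact: p].
      rewrite -ge0_integralD//; try first
        [by move=> t _; apply: mule_ge0; [rewrite lee_fin|exact: p]
        |by apply: measurable_funeM; exact: m1|by move=> t _; exact: p|exact: m1].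
      apply: ge0_le_integral => //.
      - by apply: (m1 _ (delay_map z)); exact: measurable_delay_map.
      - by apply: emeasurable_funD; [apply: measurable_funeM; exact: m1|exact: m1].
      - move=> t _; rewrite -EFinM -EFinD lee_fin mulrCA -mulrDr ler_wpM2l ?ew_ge0//.
        rewrite -(normrM F0) (le_trans _ (ler_normD _ _))// /delay_map normrM indicE.
        by case: (_ \in _); rewrite ?normr1 ?mul1r ?normr0 ?mul0r.
    rewrite wk//; apply: le_trans (leeD2l _ (wnorm_conv _ mk mH)) _.
    rewrite wk//.
    apply: le_trans (leeD2l _ (lee_wpmul2l _ (wnorm_delay_field (ltW l00) zi))) _.
      by rewrite lee_fin powR_ge0.
    apply: le_trans (leeD2l _ (lee_wpmul2l _ (lee_wpmul2l _ zK))) _.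
    - by rewrite lee_fin powR_ge0.
    - by rewrite lee_fin mulr_ge0.
    rewrite -!EFinM -EFinD lee_fin.
    have : l0 `^ (- al) * (2 * C) <= 2^-1.
      apply: (@le_trans _ _ ((4 * (C + 1))^-1 * (2 * C))).
        by rewrite ler_wpM2r ?mulr_ge0// l0P.
      by rewrite mulrC ler_pdivrMr ?mulr_gt0 ?ltr_wpDl//; lra.
    move=> /(ler_wpM2r K0); rewrite /K => H; lra.
  - move=> z z' zb zb'.
    have zi := in_ball_integrable (ltW l00) zb; have [mz z0 zK] := zb.
    have zi' := in_ball_integrable (ltW l00) zb'; have [mz' z0' zK'] := zb'.
    have mH := measurable_delay_field zi; have mH' := measurable_delay_field zi'.
    have mHH := measurable_funB mH mH'.
    have aeE : {ae mu, forall t, (ew lam t * `|(delay_map z \- delay_map z') t| <=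
       ew lam t * `|conv k (delay_field z \- delay_field z') t|)}.
      apply: ae_imp2 (ae_conv_integrable (ltW l00) zb) (ae_conv_integrable (ltW l00) zb') => t it it'.
      rewrite ler_wpM2l ?ew_ge0//.
      have -> : (delay_map z \- delay_map z') t = \1_(`]0, T[%classic : set R) t *
          conv k (delay_field z \- delay_field z') t.
        have -> : conv k (delay_field z \- delay_field z') t =
            conv k (delay_field z) t - conv k (delay_field z') t.
          rewrite /conv -RintegralB//; apply: eq_Rintegral => s _.
          by rewrite /= mulrBr.
        by rewrite /delay_map /=; ring.
      by rewrite indicE; case: (_ \in _); rewrite ?mul1r ?mul0r ?normr0.
    apply: (@le_trans _ _ (wnorm (ew lam) (conv k (delay_field z \- delay_field z')%R))).
      apply: ae_ge0_le_integral => //.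
      - by apply: (m1 _ (_ \- _)); apply: measurable_funB; exact: measurable_delay_map.
      - by apply: m1; exact: measurable_conv.
      - by apply: ae_imp aeE => t H _; rewrite lee_fin.
    apply: le_trans (wnorm_conv _ mk mHH) _; rewrite wk//.
    have zz : (wnorm (ew lam) (z \- z')%R < +oo)%E.
      apply: wnorm_supp_lty; first exact: ltW.
        have := integrableB measurableT zi zi'.
        by apply: eq_integrable => // t _; rewrite /= -EFinB.
      by move=> t nt; rewrite /= z0// z0'// subrr.
    have := wnorm_delay_field_diff (ltW lam0) zi zi' zz (in_ball_bound (ltW l00) zb').
    move=> /(lee_wpmul2l (x := (lam `^ (- al))%:E)).
    rewrite lee_fin powR_ge0 => /(_ isT); move/le_trans; apply.
    rewrite muleA -EFinM; apply: lee_wpmul2r.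
      by apply: integral_ge0 => t _; exact: p.
    rewrite lee_fin -/M.
    have CLM : 0 <= 2 * C + 2 * L * M by move: (mulr_ge0 L_ge0 M0) C_ge0; lra.
    have CLM' : 0 < 4 * (C + L * M + 1) by rewrite -invr_gt0.
    apply: (@le_trans _ _ ((4 * (C + L * M + 1))^-1 * (2 * C + 2 * L * M))).
      by apply: ler_wpM2r => //; apply: l1P; rewrite le_max lexx orbT.
    by rewrite mulrC ler_pdivrMr//; lra.
exists z; split => //.
- exact: in_ball_integrable (ltW l00) zb.
- by case: zb.
- by apply: ae_imp zfix.
Qed.

End delay_fixpoint.

(** * From the integral equation to the Caputo equation *)

Section volterra.
Context {R : realType}.
Local Notation mu := (@lebesgue_measure R).
Variables (al T F0 : R) (z h : R -> R).
Hypotheses (al_gt0 : 0 < al) (al_le1 : al <= 1).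
Hypotheses (zi : mu.-integrable setT (EFin \o z)) (hi : mu.-integrable setT (EFin \o h)).
Hypotheses (z_le0 : forall s, s <= 0 -> z s = 0) (h_le0 : forall s, s <= 0 -> h s = 0).
Hypothesis zE : {ae mu, forall s, 0 < s < T -> z s = F0 * fkern al s + conv (fkern al) h s}.

Local Notation k := (fkern al).
Let mk : measurable_fun [set: R] k := @measurable_fkern R al.
Let mth : measurable_fun [set: R] (@heaviside R) := @measurable_heaviside R.
Let k_ge0 t : 0 <= k t. Proof. exact: fkern_ge0. Qed.

Lemma heaviside_le0 (s : R) : s <= 0 -> heaviside s = 0.
Proof. by move=> s0; rewrite heavisideE ltNge s0. Qed.

Lemma conv_le0 (f : R -> R) s : (forall t, t <= 0 -> f t = 0) -> s <= 0 -> conv f h s = 0.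
Proof.
move=> f0 s0; rewrite /conv; under eq_Rintegral => r _.
  rewrite (_ : _ * _ = 0); first over.
  have [r0|r0] := leP r 0; first by rewrite h_le0// mulr0.
  by rewrite f0 ?mul0r//; lra.
by rewrite /Rintegral integral0.
Qed.

Lemma volterra_before : {ae mu, forall s, s < T -> z s = F0 * k s + conv k h s}.
Proof.
apply: ae_imp zE => s sE sT; have [s0|s0] := leP s 0; last by rewrite sE// s0.
by rewrite z_le0// fkern_le0// mulr0 add0r conv_le0//; exact: fkern_le0.
Qed.

Lemma heaviside_fkern_bound (x t : R) : x <= t ->
  (\int[mu]_s `|heaviside (x - s) * k s|%:E <= (expR t)%:E)%E.
Proof.
move=> xt; apply: (@le_trans _ _ (\int[mu]_s ((expR t)%:E * (ew 1 s * k s)%:E))%E).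
  apply: ge0_le_integral => //.
  - apply: measurable_norm_EFin; exact: (measurable_conv_section x mth mk).
  - apply: measurable_funeM; apply/measurable_EFinP/measurable_funM => //; exact: measurable_ew.
  - move=> s _; rewrite -EFinM lee_fin heavisideE subr_gt0.
    have [sx|_] := ltP s x; last by rewrite mul0r normr0; apply: mulr_ge0; [exact: expR_ge0|apply: mulr_ge0; [exact: ew_ge0|]].
    rewrite mul1r ger0_norm// mulrA ler_peMl// /ew -expRD mulN1r.
    by rewrite -expR0 ler_expR subr_ge0 (le_trans (ltW sx)).
rewrite ge0_integralZl//.
- by rewrite laplace_fkern// powR1 mule1.
- by apply/measurable_EFinP/measurable_funM => //; exact: measurable_ew.
- by move=> s _; rewrite lee_fin mulr_ge0// ew_ge0.
Qed.

(** Convolving the integral equation with f, which may be singular as long as its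
    convolution with the kernel is bounded; only the past of t matters. *)
Lemma volterra_conv (f : R -> R) (t M : R) : t < T -> measurable_fun [set: R] f ->
  (forall s, s <= 0 -> f s = 0) ->
  (forall x, x <= t -> (\int[mu]_s `|f (x - s) * k s|%:E <= M%:E)%E) ->
  mu.-integrable setT (EFin \o (fun s => f (t - s) * z s)) /\
  conv f z t = F0 * conv f k t + conv (conv f k) h t.
Proof.
move=> tT mf f_le0 fkM.
have mz := integrable_measurable zi; have mh := integrable_measurable hi.
have [] := @conv_assoc R f k h t M mf mk hi.
  move=> r hr; apply: fkM; rewrite gerBl leNgt; apply/negP => r0.
  by move/eqP: hr; apply; rewrite h_le0// ltW.
move=> fkhi fkhE.
have fki : mu.-integrable setT (EFin \o (fun s => f (t - s) * k s)).
  apply/integrableP; split; first by apply/measurable_EFinP; exact: measurable_conv_section.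
  by apply: le_lt_trans (fkM t (lexx _)) _; rewrite ltry.
have F0fki : mu.-integrable setT (EFin \o (fun s => F0 * (f (t - s) * k s))).
  have := integrableZl measurableT F0 fki.
  by apply: eq_integrable => // s _; rewrite /= -EFinM.
have sumi := integrableD measurableT F0fki fkhi.
have aeE : {ae mu, forall s, f (t - s) * z s = F0 * (f (t - s) * k s) + f (t - s) * conv k h s}.
  apply: ae_imp volterra_before => s sE.
  have [st|ts] := ltP s t; first by rewrite sE ?(lt_trans st)//; ring.
  by rewrite f_le0 ?subr_le0// !mul0r mulr0 addr0.
have mfz := measurable_conv_section t mf mz.
have msum : measurable_fun [set: R]
   (fun s => F0 * (f (t - s) * k s) + f (t - s) * conv k h s).
  apply: measurable_funD; first by apply: measurable_funM => //; exact: measurable_conv_section.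
  by apply: measurable_conv_section => //; exact: measurable_conv.
split.
  apply/integrableP; split; first exact/measurable_EFinP.
  case/integrableP : sumi => _; apply: le_lt_trans.
  rewrite le_eqVlt; apply/orP; left; apply/eqP; apply: ae_eq_integral => //.
  - exact: (measurable_norm_EFin mfz).
  - exact: (measurable_norm_EFin msum).
  - by apply: ae_imp aeE => s E _; rewrite /= E.
rewrite -fkhE {1 2 3}/conv -RintegralZl// -RintegralD// /Rintegral; congr fine.
apply: ae_eq_integral => //.
- exact/measurable_EFinP.
- exact/measurable_EFinP.
- by apply: ae_imp aeE => s -> _.
Qed.

Lemma conv_fkern_heaviside r : al < 1 -> conv (fkern (1 - al)) k r = heaviside r.
Proof.
move=> al1; rewrite /conv /Rintegral.
have /= <- := congr1 fine (conv_fkern r al_gt0 al1).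
have al'0 : 0 < 1 - al by rewrite subr_gt0.
have al'1 : 1 - al <= 1 by rewrite gerBl ltW.
congr fine; apply: eq_integral => s _; rewrite ger0_norm// mulr_ge0//.
exact: fkern_ge0.
Qed.

(** Convolution with the kernel of complementary order turns the kernel k into the
    constant 1: the Caputo derivative of the state is the forcing. *)
Lemma volterra_caputo t : al < 1 -> 0 < t -> t < T ->
  mu.-integrable setT (EFin \o (fun s => fkern (1 - al) (t - s) * z s)) /\
  conv (fkern (1 - al)) z t = F0 + primitive h t.
Proof.
move=> al1 t0 tT; have al'0 : 0 < 1 - al by rewrite subr_gt0.
have al'1 : 1 - al <= 1 by rewrite gerBl ltW.
have [fzi ->] := @volterra_conv (fkern (1 - al)) t 1 tT (@measurable_fkern R (1 - al))
   (fun s => @fkern_le0 R (1 - al) s)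
   (fun x _ => ltac:(rewrite conv_fkern// lee_fin heavisideE; by case: (0 < x)%R)).
split => //; rewrite conv_fkern_heaviside// heavisideE t0 mulr1; congr (_ + _).
by apply: eq_Rintegral => s _; rewrite conv_fkern_heaviside.
Qed.

(** Integrating the equation for z once gives the usual Volterra equation for the
    state, since fractional and ordinary integration commute. *)
Lemma volterra_state t : t < T ->
  primitive z t = conv k (fun s => heaviside s * (F0 + primitive h s)) t.
Proof.
move=> tT; have mh := integrable_measurable hi.
have [_ E] := @volterra_conv heaviside t (expR t) tT mth heaviside_le0
   (fun x => @heaviside_fkern_bound x t).
rewrite [LHS]E {E}.
have fub x : x <= t -> (\int[mu]_s `|k (x - s) * heaviside s|%:E <= (expR t)%:E)%E.
  move=> xt; apply: le_trans (heaviside_fkern_bound xt).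
  have m1 : measurable_fun [set: R] (fun s => `|heaviside (x - s) * k s|%:E).
    by apply: measurable_norm_EFin; exact: (measurable_conv_section x mth mk).
  rewrite -[leRHS](@integral_isometry R (-1) x _ (normrN1 _) m1).
  rewrite le_eqVlt; apply/orP; left; apply/eqP; apply: eq_integral => s _.
  by rewrite mulN1r [- s + x]addrC subKr mulrC.
have [] := @conv_assoc R k heaviside h t (expR t) mk mth hi.
  move=> r hr; apply: fub; rewrite gerBl leNgt; apply/negP => r0.
  by move/eqP: hr; apply; rewrite h_le0// ltW.
move=> khhi khhE.
have cC x : conv heaviside k x = conv k heaviside x by exact: convC.
rewrite cC (_ : conv (conv heaviside k) h t = conv (conv k heaviside) h t); last first.
  by apply: eq_Rintegral => s _; rewrite cC.
rewrite -khhE.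
have ki : mu.-integrable setT (EFin \o (fun s => k (t - s) * heaviside s)).
  apply/integrableP; split; first by apply/measurable_EFinP; exact: measurable_conv_section.
  by apply: le_lt_trans (fub t (lexx _)) _; rewrite ltry.
rewrite {1 2}/conv -RintegralZl// -RintegralD//; last first.
  have := integrableZl measurableT F0 ki.
  by apply: eq_integrable => // s _; rewrite /= -EFinM.
apply: eq_Rintegral => s _.
have [s0|s0] := leP s 0; last by rewrite heavisideE s0 mulr1 mul1r /primitive; ring.
by rewrite heaviside_le0// conv_le0//; [ring|exact: heaviside_le0].
Qed.

End volterra.

(** * Chain rule along absolutely continuous functions *)

Section density.
Context {R : realType}.
Local Notation mu := (@lebesgue_measure R).
Implicit Types (x y z w : R -> R).

(** x is absolutely continuous on the whole line with derivative z and limit x0 at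
    minus infinity. *)
Definition density (x0 : R) z x :=
  mu.-integrable setT (EFin \o z) /\ forall t, x t = x0 + primitive z t.

Lemma density_lin (a b x0 y0 : R) z w x y : density x0 z x -> density y0 w y ->
  density (a * x0 + b * y0) (fun s => a * z s + b * w s) (fun t => a * x t + b * y t).
Proof.
move=> [zi xE] [wi yE].
have azi t : mu.-integrable setT (EFin \o (fun s => a * (heaviside (t - s) * z s))).
  have := integrableZl measurableT a (integrable_heaviside_mul t zi).
  by apply: eq_integrable => // s _; rewrite /= -EFinM.
have bwi t : mu.-integrable setT (EFin \o (fun s => b * (heaviside (t - s) * w s))).
  have := integrableZl measurableT b (integrable_heaviside_mul t wi).
  by apply: eq_integrable => // s _; rewrite /= -EFinM.
split.
  have := integrableD measurableT (integrableZl measurableT a zi) (integrableZl measurableT b wi).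
  by apply: eq_integrable => // s _; rewrite /= -!EFinM -EFinD.
move=> t; rewrite xE yE.
have -> : primitive (fun s => a * z s + b * w s) t = a * primitive z t + b * primitive w t.
  rewrite /primitive /conv -RintegralZl//; last exact: integrable_heaviside_mul.
  rewrite -[X in _ + X]RintegralZl//; last exact: integrable_heaviside_mul.
  rewrite -RintegralD//; apply: eq_Rintegral => s _; ring.
ring.
Qed.

Lemma density_mul (x0 y0 : R) z w x y : density x0 z x -> density y0 w y ->
  density (x0 * y0) (fun s => z s * y s + x s * w s) (fun t => x t * y t).
Proof.
move=> [zi xE] [wi yE].
have zyi : mu.-integrable setT (EFin \o (fun s => z s * primitive w s)) by exact: integrable_mul_primitive.
have wxi : mu.-integrable setT (EFin \o (fun s => w s * primitive z s)) by exact: integrable_mul_primitive.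
have d1 : density 0 (fun s => z s * primitive w s + w s * primitive z s)
    (fun t => primitive z t * primitive w t).
  split; last by move=> t; rewrite add0r Rintegral_primitive_mul.
  by have := integrableD measurableT zyi wxi; apply: eq_integrable.
have d2 : density (x0 * y0) (fun s => y0 * z s + x0 * w s)
    (fun t => x0 * y0 + (y0 * primitive z t + x0 * primitive w t)).
  have [i e] := density_lin y0 x0 (conj zi (fun t => esym (add0r (primitive z t))))
    (conj wi (fun t => esym (add0r (primitive w t)))).
  by split => // t; rewrite e !mulr0 addr0 add0r.
have [i e] := density_lin 1 1 d2 d1.
have fE : (fun s => z s * y s + x s * w s) = (fun s =>
    1 * (y0 * z s + x0 * w s) + 1 * (z s * primitive w s + w s * primitive z s)).
  by apply/funext => s; rewrite xE yE; ring.
rewrite fE; split => // t.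
apply: (etrans _ (etrans (e t) _)); first by rewrite xE yE; ring.
by congr (_ + _); ring.
Qed.

Lemma density_shift (x0 tau : R) z x : density x0 z x ->
  density x0 (fun s => z (s - tau)) (fun t => x (t - tau)).
Proof.
move=> [zi xE]; have mz := integrable_measurable zi.
split; first exact: integrable_shift.
move=> t; rewrite xE; congr (_ + _).
rewrite /primitive /conv -(Rintegral_shift tau (measurable_conv_section (t - tau) (@measurable_heaviside R) mz)).
by apply: eq_Rintegral => s _; congr (heaviside _ * _); ring.
Qed.

(** The vector field in coordinates centred at the equilibrium: u is the present and
    v the delayed deviation. *)
Definition cubic_field (a b p c2 e u v : R) : R :=
  a * u + b * v - p * u ^+ 2 + c2 * v ^+ 2 + e * v ^+ 3.

(** Chain rule along an absolutely continuous state: it identifies the primitive of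
    the delay field with the value of the nonlinearity. *)
Lemma density_cubic_field (a b p c2 e x0 y0 : R) z w x y : density x0 z x -> density y0 w y ->
  density (cubic_field a b p c2 e x0 y0)
    (fun s => (a - 2 * p * x s) * z s + (b + 2 * c2 * y s + 3 * e * y s ^+ 2) * w s)
    (fun t => cubic_field a b p c2 e (x t) (y t)).
Proof.
move=> dx dy.
have dxx := density_mul dx dx; have dyy := density_mul dy dy.
have dyyy := density_mul dyy dy.
have [i e'] := density_lin 1 1 (density_lin 1 1 (density_lin a b dx dy)
  (density_lin (- p) c2 dxx dyy)) (density_lin e 0 dyyy dyyy).
have fE : (fun s => (a - 2 * p * x s) * z s + (b + 2 * c2 * y s + 3 * e * y s ^+ 2) * w s) =
  (fun s => 1 * (1 * (a * z s + b * w s) + 1 * (- p * (z s * x s + x s * z s) +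
    c2 * (w s * y s + y s * w s))) + 1 * (e * ((w s * y s + y s * w s) * y s + y s * y s * w s)
    + 0 * ((w s * y s + y s * w s) * y s + y s * y s * w s))).
  by apply/funext => s; ring.
rewrite fE; split => // t; have := e' t; rewrite /cubic_field => E.
apply: (etrans _ (etrans E _)); first by ring.
by congr (_ + _); ring.
Qed.

End density.

(** * The Laplace transform of a bounded trajectory *)

Section laplace.
Context {R : realType}.
Local Notation mu := (@lebesgue_measure R).
Variables (al lam tau a b c eta Cg : R).
Hypotheses (al_gt0 : 0 < al) (al_le1 : al <= 1) (lam_gt0 : 0 < lam) (tau_ge0 : 0 <= tau).
Hypothesis c_ge0 : 0 <= c.
Hypothesis root : lam `^ al = a + b * expR (- lam * tau).
Local Notation k := (fkern al).

Let W t : R := ew lam t * heaviside t.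

Let mW : measurable_fun [set: R] W.
Proof. by apply: measurable_funM; [exact: measurable_ew|exact: measurable_heaviside]. Qed.

Let W_ge0 t : 0 <= W t. Proof. by rewrite mulr_ge0 ?ew_ge0 ?heaviside_ge0. Qed.

Let Wi : mu.-integrable setT (EFin \o W).
Proof.
apply/integrableP; split; first exact/measurable_EFinP.
apply: le_lt_trans (ltry lam^-1); rewrite -laplace_heaviside//.
by rewrite le_eqVlt; apply/orP; left; apply/eqP/eq_integral => t _; rewrite /= ger0_norm.
Qed.

Let intW : \int[mu]_t W t = lam^-1.
Proof. by rewrite /Rintegral laplace_heaviside. Qed.

Let bi (M : R) (f : R -> R) : measurable_fun [set: R] f -> (forall s, `|f s| <= M) ->
  mu.-integrable setT (EFin \o (fun s => f s * W s)).
Proof. by move=> mf fM; exact: integrable_mul_bounded Wi. Qed.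

Lemma wnorm_bounded (l M : R) (f : R -> R) : 0 < l -> measurable_fun [set: R] f ->
  (forall s, s <= 0 -> f s = 0) -> (forall s, `|f s| <= M) ->
  (wnorm (ew l) f <= (M * l^-1)%:E)%E.
Proof.
move=> l0 mf f0 fM; rewrite EFinM -laplace_heaviside// -ge0_integralZl//; last 3 first.
- apply/measurable_EFinP/measurable_funM; first exact: measurable_ew.
  exact: measurable_heaviside.
- by move=> t _; rewrite lee_fin mulr_ge0 ?ew_ge0 ?heaviside_ge0.
- by rewrite lee_fin (le_trans _ (fM 0)).
apply: ge0_le_integral => //.
- by move=> t _; rewrite lee_fin mulr_ge0// ew_ge0.
- apply/measurable_EFinP/measurable_funM; first exact: measurable_ew.
  exact: measurableT_comp.
- apply: measurable_funeM; apply/measurable_EFinP/measurable_funM; first exact: measurable_ew.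
  exact: measurable_heaviside.
- move=> t _; rewrite -EFinM lee_fin mulrCA ler_wpM2l ?ew_ge0//.
  have [t0|t0] := leP t 0; last by rewrite heavisideE t0 mulr1.
  by rewrite f0// normr0 heavisideE ltNge t0 mulr0.
Qed.

(** Bounds the integral of |Z - k convolved with the forcing| in the weight
    e^(-lam t / 2), whatever the horizon T. *)
Definition tail_const : R := ((eta + c) * (lam / 2)^-1 + (lam / 2) `^ (- al) * (Cg * (lam / 2)^-1)).

(** The heart of the instability. Take the Laplace transform at lam of the Volterra
    equation of Z, the deviation from the history - c. On an infinite horizon
    the terms in Z cancel because lam is a characteristic root, and
    lam^(-al) c (a + b) / lam equals the transform of N up to a positive factor, which is
    impossible as N <= 0. On ]-oo, T[ the equation fails only after time T, which
    costs at most e^(-lam T / 2) times a constant. *)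
Lemma laplace_bound (T : R) (Z N : R -> R) :
  0 <= T -> measurable_fun [set: R] Z -> measurable_fun [set: R] N ->
  (forall t, t <= 0 -> Z t = 0) -> (forall t, `|Z t - c| <= eta) ->
  (forall t, N t <= 0) ->
  (forall t, `|a * (Z t - c) + b * (Z (t - tau) - c) + N t| <= Cg) ->
  (forall t, t < T ->
     Z t = conv k (fun s => heaviside s * (a * (Z s - c) + b * (Z (s - tau) - c) + N s)) t) ->
  lam `^ (- al) * (c * (a + b)) / lam <= expR (- (lam / 2 * T)) * tail_const.
Proof.
move=> T0 mZ mN Z0 Zeta N0 GC ZE.
pose G s := a * (Z s - c) + b * (Z (s - tau) - c) + N s.
pose Gt s := heaviside s * G s.
have mZs : measurable_fun [set: R] (fun s => Z (s - tau)).
  by apply: (measurableT_comp mZ); exact: measurable_funB.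
have mG : measurable_fun [set: R] G.
  apply: measurable_funD => //; apply: measurable_funD; apply: measurable_funM => //;
  exact: measurable_funB.
have mGt : measurable_fun [set: R] Gt by apply: measurable_funM => //; exact: measurable_heaviside.
have mk : measurable_fun [set: R] k by exact: measurable_fkern.
have ZM t : `|Z t| <= eta + c.
  by rewrite -[Z t](subrK c) (le_trans (ler_normD _ _))// lerD// ger0_norm.
have Gt0 s : s <= 0 -> Gt s = 0 by move=> s0; rewrite /Gt heaviside_le0// mul0r.
have GtC s : `|Gt s| <= Cg.
  by rewrite /Gt normrM (le_trans _ (GC s))// ler_piMl// heaviside_le1.
pose D t := Z t - conv k Gt t.
have mconv : measurable_fun [set: R] (conv k Gt) by exact: measurable_conv.
have mD : measurable_fun [set: R] D by exact: measurable_funB.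
have l2 : 0 < lam / 2 by rewrite divr_gt0.
have wD : (wnorm (ew (lam / 2)) D <= tail_const%:E)%E.
  have -> : wnorm (ew (lam / 2)) D = wnorm (ew (lam / 2)) (Z \- conv k Gt)%R by [].
  apply: le_trans (wnorm_triangle (measurable_ew (lam / 2)) (ew_gt0 (lam / 2)) mZ
    (@measurable_cst _ _ _ _ setT (0 : R)) mconv) _.
  rewrite EFinD; apply: leeD.
    apply: le_trans (wnorm_bounded l2 mZ Z0 ZM).
    rewrite le_eqVlt; apply/orP; left; apply/eqP; apply: eq_integral => t _.
    by rewrite /= subr0.
  apply: (@le_trans _ _ (wnorm (ew (lam / 2)) (conv k Gt))).
    rewrite le_eqVlt; apply/orP; left; apply/eqP; apply: eq_integral => t _.
    by rewrite /= sub0r normrN.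
  apply: le_trans (wnorm_conv _ mk mGt) _; rewrite EFinM; apply: lee_pmul.
  - by apply: integral_ge0 => t _; rewrite lee_fin mulr_ge0// ew_ge0.
  - by apply: integral_ge0 => t _; rewrite lee_fin mulr_ge0// ew_ge0.
  - rewrite -laplace_fkern// le_eqVlt; apply/orP; left; apply/eqP; apply: eq_integral => t _.
    by rewrite ger0_norm// fkern_ge0.
  - exact: wnorm_bounded.
have D0 t : t < T -> D t = 0 by move=> tT; rewrite /D {1}ZE// subrr.
have wDl : (wnorm (ew lam) D <= (expR (- (lam / 2 * T)) * tail_const)%:E)%E.
  apply: (@le_trans _ _ ((expR (- (lam / 2 * T)))%:E * wnorm (ew (lam / 2)) D)%E); last first.
    by rewrite EFinM; apply: lee_wpmul2l => //; rewrite lee_fin expR_ge0.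
  have mDw l : measurable_fun [set: R] (fun t => (ew l t * `|D t|)%:E).
    apply/measurable_EFinP/measurable_funM; first exact: measurable_ew.
    exact: measurableT_comp.
  rewrite /wnorm -ge0_integralZl//; last 2 first.
  - exact: mDw.
  - by move=> t _; rewrite lee_fin mulr_ge0// ew_ge0.
  apply: ge0_le_integral => //.
  - by move=> t _; rewrite lee_fin mulr_ge0// ew_ge0.
  - exact: mDw.
  - by apply: measurable_funeM; exact: mDw.
  - move=> t _; rewrite -EFinM lee_fin mulrA.
    have [/D0 ->|Tt] := ltP t T; first by rewrite normr0 !mulr0.
    rewrite ler_wpM2r// /ew -expRD ler_expR.
    have : lam / 2 * T <= lam / 2 * t by rewrite ler_wpM2l// ltW.
    have -> : - lam * t = - (lam / 2 * t) - (lam / 2 * t) by field.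
    rewrite mulNr; lra.
pose fk t := ew lam t * k t; pose fG t := ew lam t * Gt t.
have fki : mu.-integrable setT (EFin \o fk) by exact: ew_fkern_integrable.
have fGE t : fG t = G t * W t by rewrite /fG /Gt /W; ring.
have fGE' : fG = (fun t => Gt t * W t).
  apply/funext => t; rewrite /fG /Gt /W !heavisideE.
  by case: (0 < t)%R; rewrite ?mul0r ?mulr0 ?mul0r// !mulr1 mul1r mulrC.
have fGi : mu.-integrable setT (EFin \o fG).
  by rewrite fGE'; exact: (bi mGt GtC).
have ci := integrable_conv fki fGi.
have ZWE t : ew lam t * Z t = Z t * W t.
  rewrite /W heavisideE; have [t0|t0] := leP t 0; first by rewrite Z0// mulr0 mul0r.
  by rewrite mulr1 mulrC.
have ZWi : mu.-integrable setT (EFin \o (fun t => Z t * W t)) by exact: (bi mZ ZM).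
(* The weight e^(-lam t) is multiplicative and passes inside convolutions. *)
have ae1 : {ae mu, forall t, conv fk fG t = ew lam t * conv k Gt t}.
  have Ki := integrable_conv_kernel fki fGi.
  apply: ae_imp (ae_integrable1 Ki) => t it.
  have kGi : mu.-integrable setT (EFin \o (fun s => k (t - s) * Gt s)).
    have := integrableZl measurableT (ew lam t)^-1 it.
    apply: eq_integrable => // s _; rewrite /= -EFinM; congr EFin.
    by rewrite /fk /fG (ewB lam t s) mulrACA mulKf// mulf_neq0// gt_eqF// ew_gt0.
  rewrite {2}/conv -RintegralZl//; apply: eq_Rintegral => s _.
  by rewrite /fk /fG (ewB lam t s) mulrACA.
(* D vanishes before T and |D| has a finite e^(-lam t / 2)-weighted integral,
   so that its e^(-lam t)-weighted integral is small. *)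
have key : \int[mu]_t (Z t * W t) - \int[mu]_t conv fk fG t <= expR (- (lam / 2 * T)) * tail_const.
  rewrite -RintegralB//; rewrite (le_trans (ler_norm _))//.
  have di : mu.-integrable setT (EFin \o (fun t => Z t * W t - conv fk fG t)).
    by have := integrableB measurableT ZWi ci; apply: eq_integrable.
  rewrite -lee_fin EFin_normr_Rintegral//.
  apply: le_trans wDl; apply: le_trans (le_abse_integral mu measurableT _) _.
    by case/integrableP : di.
  rewrite le_eqVlt; apply/orP; left; apply/eqP; apply: ae_eq_integral => //.
  - by apply: measurableT_comp => //; case/integrableP : di.
  - apply/measurable_EFinP/measurable_funM; first exact: measurable_ew.
    exact: measurableT_comp.
  - apply: ae_imp ae1 => t E _.
    by rewrite /= E -ZWE -mulrBr normrM ger0_norm// ew_ge0.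
have intk : \int[mu]_t fk t = lam `^ (- al) by rewrite /Rintegral laplace_fkern.
apply: le_trans key; rewrite Rintegral_conv// intk.
have shiftW : \int[mu]_t (Z (t - tau) * W t) = expR (- lam * tau) * \int[mu]_t (Z t * W t).
  rewrite -[in RHS](Rintegral_shift tau (integrable_measurable ZWi)) -RintegralZl//.
    apply: eq_Rintegral => t _; rewrite -ZWE.
    have [t0|t0] := leP t 0.
      have -> : Z (t - tau) = 0 by apply: Z0; rewrite subr_le0 (le_trans t0).
      by rewrite !mulr0 mul0r.
    by rewrite /W heavisideE t0 mulr1 (ewB lam t tau) [ew lam tau]/ew mulrC mulrCA mulrA.
  exact: (integrable_shift tau ZWi).
have NC t : `|N t| <= Cg + `|a| * eta + `|b| * eta.
  have -> : N t = G t - a * (Z t - c) - b * (Z (t - tau) - c) by rewrite /G; ring.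
  apply: le_trans (ler_normB _ _) _; apply: lerD; last by rewrite normrM ler_wpM2l.
  apply: le_trans (ler_normB _ _) _; apply: lerD; first exact: GC.
  by rewrite normrM ler_wpM2l.
have NWi := bi mN NC.
have ZsWi : mu.-integrable setT (EFin \o (fun t => Z (t - tau) * W t)).
  exact: (bi mZs (fun s => ZM (s - tau))).
have -> : \int[mu]_t fG t = a * \int[mu]_t (Z t * W t) + b * \int[mu]_t (Z (t - tau) * W t)
    - c * (a + b) * \int[mu]_t W t + \int[mu]_t (N t * W t).
  have azi := integrableZl measurableT a ZWi; have bzi := integrableZl measurableT b ZsWi.
  have wi := integrableZl measurableT (c * (a + b)) Wi.
  have abi : mu.-integrable setT (EFin \o (fun t => a * (Z t * W t) + b * (Z (t - tau) * W t))).
    by have := integrableD measurableT azi bzi; apply: eq_integrable.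
  have abwi : mu.-integrable setT (EFin \o (fun t => a * (Z t * W t) + b * (Z (t - tau) * W t)
      - c * (a + b) * W t)).
    by have := integrableB measurableT abi wi; apply: eq_integrable.
  rewrite -!RintegralZl// -RintegralD// -RintegralB// -RintegralD//.
  by apply: eq_Rintegral => t _; rewrite fGE /G; ring.
have NWle : \int[mu]_t (N t * W t) <= 0.
  rewrite -oppr_ge0 -[X in - X]mul1r -mulNr -RintegralZl//.
  by apply: Rintegral_ge0 => t _; rewrite mulN1r oppr_ge0 mulr_le0_ge0.
rewrite shiftW intW; set I := \int[mu]_t (Z t * W t).
have K0 : 0 <= lam `^ (- al) by exact: powR_ge0.
(* This is where lam is a root: the transform of Z cancels. *)
have Kroot : lam `^ (- al) * (a + b * expR (- lam * tau)) = 1.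
  by rewrite -root -powR_add// addNr powRr0.
have -> : I - lam `^ (- al) * (a * I + b * (expR (- lam * tau) * I) - c * (a + b) / lam + \int[mu]_t (N t * W t))
  = I * (1 - lam `^ (- al) * (a + b * expR (- lam * tau))) + lam `^ (- al) * (c * (a + b)) / lam - lam `^ (- al) * \int[mu]_t (N t * W t).
  by ring.
rewrite Kroot subrr mulr0 add0r lerDl -mulrN mulr_ge0// oppr_ge0//.
Qed.

End laplace.

(** * Clipped trajectories *)

Section clip.
Context {R : realType}.
Implicit Types (eta u v : R).

(** Truncation of u to [- eta, eta], in a form that makes continuity and the
    Lipschitz bound immediate. *)
Definition clip eta u : R := (`|u + eta| - `|u - eta|) / 2.

Lemma clip_le eta u : 0 <= eta -> `|clip eta u| <= eta.
Proof.
move=> eta0; rewrite /clip normrM [`|2^-1|]ger0_norm// ler_pdivrMr//.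
apply: le_trans (ler_dist_dist _ _) _.
have -> : u + eta - (u - eta) = eta * 2 by ring.
by rewrite ger0_norm// mulr_ge0.
Qed.

Lemma clip_lip eta u v : `|clip eta u - clip eta v| <= `|u - v|.
Proof.
have -> : clip eta u - clip eta v =
  ((`|u + eta| - `|v + eta|) - (`|u - eta| - `|v - eta|)) / 2 by rewrite /clip; field.
rewrite normrM [`|2^-1|]ger0_norm// ler_pdivrMr// mulr_natr mulr2n.
apply: le_trans (ler_normB _ _) _; apply: lerD; apply: le_trans (ler_dist_dist _ _) _.
- by rewrite (_ : u + eta - (v + eta) = u - v)//; ring.
- by rewrite (_ : u - eta - (v - eta) = u - v)//; ring.
Qed.

Lemma clip_id eta u : `|u| <= eta -> clip eta u = u.
Proof.
rewrite ler_norml => /andP[u1 u2]; rewrite /clip ger0_norm; last lra.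
rewrite ler0_norm; last lra.
by field.
Qed.

Lemma clip_continuous eta : continuous (clip eta : R -> R).
Proof.
move=> u; apply: cvgM; last exact: cvg_cst.
apply: cvgB; apply: cvg_norm; apply: cvgD => //; exact: cvg_cst.
Qed.

End clip.

Section trajectory.
Context {R : realType}.
Local Notation mu := (@lebesgue_measure R).
Variables (al T tau y0 eta a b p c2 e : R).
Hypotheses (al_gt0 : 0 < al) (al_le1 : al <= 1).
Hypotheses (tau_ge0 : 0 <= tau) (eta_ge0 : 0 <= eta).

Local Notation g := (cubic_field a b p c2 e).
Local Notation F0 := (g y0 y0).

Let A (u : R) : R := a - 2 * p * clip eta u.
Let B (u : R) : R := b + 2 * c2 * clip eta u + 3 * e * clip eta u ^+ 2.
Let C : R := `|a| + `|b| + 2 * `|p| * eta + 2 * `|c2| * eta + 3 * `|e| * eta ^+ 2.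
Let L : R := 2 * `|p| + 2 * `|c2| + 6 * `|e| * eta.

Let C_ge0 : 0 <= C. Proof. by rewrite !addr_ge0// !mulr_ge0. Qed.
Let L_ge0 : 0 <= L. Proof. by rewrite !addr_ge0// !mulr_ge0. Qed.

Let cA : continuous A.
Proof.
move=> u; apply: cvgB; first exact: cvg_cst.
by apply: cvgM; [exact: cvg_cst|exact: clip_continuous].
Qed.

Let cB : continuous B.
Proof.
move=> u; apply: cvgD; first (apply: cvgD; first exact: cvg_cst).
- by apply: cvgM; [exact: cvg_cst|exact: clip_continuous].
- apply: cvgM; first exact: cvg_cst.
  rewrite (_ : (fun x : R => clip eta x ^+ 2) = (fun x => clip eta x * clip eta x))//.
  by apply: cvgM; exact: clip_continuous.
Qed.

Let AC u : `|A u| <= C.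
Proof.
rewrite /A; move: (clip eta u) (clip_le u eta_ge0) => v vE.
apply: le_trans (ler_normB _ _) _; rewrite /C !normrM (ger0_norm (ler0n _ 2)).
have := ler_wpM2l (mulr_ge0 (ler0n R 2) (normr_ge0 p)) vE.
have := normr_ge0 b; have := mulr_ge0 (mulr_ge0 (ler0n R 2) (normr_ge0 c2)) eta_ge0.
have := mulr_ge0 (mulr_ge0 (ler0n R 3) (normr_ge0 e)) (exprn_ge0 2 eta_ge0).
lra.
Qed.

Let BC u : `|B u| <= C.
Proof.
rewrite /B; move: (clip eta u) (clip_le u eta_ge0) => v vE.
have h1 := ler_wpM2l (mulr_ge0 (ler0n R 2) (normr_ge0 c2)) vE.
have sq : `|v| ^+ 2 <= eta ^+ 2 by rewrite ler_sqr ?nnegrE.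
have h2 := ler_wpM2l (mulr_ge0 (ler0n R 3) (normr_ge0 e)) sq.
have := normr_ge0 a; have := mulr_ge0 (mulr_ge0 (ler0n R 2) (normr_ge0 p)) eta_ge0.
have := ler_normD (b + 2 * c2 * v) (3 * e * v ^+ 2).
have := ler_normD b (2 * c2 * v).
rewrite (normrM (3 * e)) (normrM 3) normrX (normrM (2 * c2)) (normrM 2).
rewrite (ger0_norm (ler0n _ 2)) (ger0_norm (ler0n _ 3)) /C.
lra.
Qed.

Let AL u v : `|A u - A v| <= L * `|u - v|.
Proof.
have -> : A u - A v = - (2 * p * (clip eta u - clip eta v)) by rewrite /A; ring.
have := clip_lip eta u v; move: (clip eta u - clip eta v) => d dE.
rewrite normrN !normrM (ger0_norm (ler0n _ 2)).
have h := ler_wpM2l (mulr_ge0 (ler0n R 2) (normr_ge0 p)) dE.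
have : 0 <= (2 * `|c2| + 6 * `|e| * eta) * `|u - v| by rewrite mulr_ge0// addr_ge0// !mulr_ge0.
rewrite /L; lra.
Qed.

Let BL u v : `|B u - B v| <= L * `|u - v|.
Proof.
set cu := clip eta u; set cv := clip eta v.
have -> : B u - B v = (2 * c2 + 3 * e * (cu + cv)) * (cu - cv).
  by rewrite /B -/cu -/cv; ring.
rewrite normrM; apply: ler_pM => //; last exact: clip_lip.
apply: le_trans (ler_normD _ _) _; rewrite !normrM (ger0_norm (ler0n _ 2)) (ger0_norm (ler0n _ 3)).
have s : `|cu + cv| <= 2 * eta.
  rewrite mulr_natl mulr2n; apply: le_trans (ler_normD _ _) _.
  by apply: lerD; exact: clip_le.
have := ler_wpM2l (mulr_ge0 (ler0n R 3) (normr_ge0 e)) s.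
have := normr_ge0 p; rewrite /L; lra.
Qed.

(** Clipping the arguments of the partial derivatives of g makes them bounded and
    Lipschitz, so the fixed point exists on any interval; up to the first time the
    state exceeds eta the clipping is not felt. *)
Lemma trajectory_exists : exists z h : R -> R,
  [/\ mu.-integrable setT (EFin \o z), (forall t, ~ `]0, T[%classic t -> z t = 0),
      mu.-integrable setT (EFin \o h), (forall t, t <= 0 -> h t = 0) &
      {ae mu, forall s, 0 < s < T -> z s = F0 * fkern al s + conv (fkern al) h s} /\
      forall t, (forall r, r <= t -> `|state y0 z r| <= eta) ->
        F0 + primitive h t = g (state y0 z t) (state y0 z (t - tau))].
Proof.
have [z [zi z0 zE]] := delay_map_fixpoint T y0 F0 al_gt0 al_le1
  tau_ge0 C_ge0 L_ge0 cA cB AC BC AL BL.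
have mz := integrable_measurable zi.
pose h := delay_field tau y0 A B z.
have z_le0 s : s <= 0 -> z s = 0.
  by move=> s0; apply: z0; rewrite /= in_itv /= ltNge s0.
have zsi := integrable_shift tau zi.
have hi : mu.-integrable setT (EFin \o h).
  have di : mu.-integrable setT (EFin \o (fun s => C * (`|z s| + `|z (s - tau)|))).
    have := integrableZl measurableT C (integrableD measurableT (integrable_norm zi) (integrable_norm zsi)).
    by apply: eq_integrable => // s _; rewrite /= -EFinD -EFinM.
  apply: le_integrable di => //.
    by apply/measurable_EFinP; exact: measurable_delay_field.
  move=> s _; rewrite /= lee_fin [leRHS]ger0_norm; first exact: delay_field_le.
  by rewrite mulr_ge0// addr_ge0.
have h_le0 t : t <= 0 -> h t = 0.
  move=> t0; rewrite /h /delay_field z_le0// z_le0 ?mulr0 ?addr0//.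
  by rewrite subr_le0 (le_trans t0).
exists z, h; split => //; split.
  apply: ae_imp zE => s sE sT; rewrite sE /delay_map indicE.
  by rewrite mem_set ?mul1r//= in_itv.
move=> t yeta.
have dy : density y0 z (state y0 z) by split.
have [h'i E] := density_cubic_field a b p c2 e dy (density_shift tau dy).
rewrite [RHS](E t); congr (_ + _); apply: eq_Rintegral => s _.
rewrite heavisideE subr_gt0; have [st|_] := ltP s t; last by rewrite !mul0r.
have e1 : clip eta (state y0 z s) = state y0 z s by apply/clip_id/yeta/ltW.
have e2 : clip eta (state y0 z (s - tau)) = state y0 z (s - tau).
  by apply/clip_id/yeta; rewrite lerBlDr (le_trans (ltW st))// lerDl.
by rewrite /h /delay_field /A /B e1 e2.
Qed.

End trajectory.

(** * Solutions in the sense of Caputo *)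

Section derivative_measurable.
Context {R : realType}.
Local Notation mu := (@lebesgue_measure R).

Lemma ae_eq_integrable (D : set R) (f g : R -> R) : measurable D ->
  measurable_fun D f -> {ae mu, forall s, D s -> f s = g s} ->
  mu.-integrable D (EFin \o g) -> mu.-integrable D (EFin \o f).
Proof.
move=> mD mf fg gi; have mg : measurable_fun D g.
  by apply/measurable_EFinP; case/integrableP : gi.
apply/integrableP; split; first exact/measurable_EFinP.
apply: le_lt_trans (proj2 (integrableP _ _ _ gi)).
rewrite le_eqVlt; apply/orP; left; apply/eqP; apply: ae_eq_integral => //.
- by apply/measurable_EFinP; exact: measurableT_comp.
- by apply/measurable_EFinP; exact: measurableT_comp.
- by apply: ae_imp fg => s fgs Ds; rewrite /= fgs.
Qed.

Lemma ae_eq_Rintegral (D : set R) (f g : R -> R) : measurable D ->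
  measurable_fun D f -> measurable_fun D g -> {ae mu, forall s, D s -> f s = g s} ->
  \int[mu]_(s in D) f s = \int[mu]_(s in D) g s.
Proof.
move=> mD mf mg fg; rewrite /Rintegral; congr fine; apply: ae_eq_integral => //.
- exact/measurable_EFinP.
- exact/measurable_EFinP.
- by apply: ae_imp fg => s fgs Ds; rewrite fgs.
Qed.

(** The set where a continuous function is differentiable is Borel, and the
    derivative is there a limit of difference quotients. This is needed because
    derive1 of the state is only known almost everywhere. *)
Lemma measurable_derive1 (x : R -> R) : continuous x -> measurable_fun [set: R] (derive1 x).
Proof.
move=> cx; pose q (h s : R) := h^-1 * (x (h + s) - x s).
have cq h : continuous (q h).
  move=> s; apply: cvgM; first exact: cvg_cst.
  apply: cvgB; last exact: cx.
  apply: (@continuous_comp _ _ _ (fun s => h + s) x); last exact: cx.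
  by apply: cvgD; [exact: cvg_cst|exact: cvg_id].
have dE s : derivable x s 1 = cvg (q h s @[h --> 0^']).
  rewrite /derivable /q.
  have -> : (fun h : R => h^-1 *: ((x \o shift s) (h *: (1 : R)) - x s)) =
    (fun h => h^-1 * (x (h + s) - x s)) by apply/funext => h; rewrite /= /GRing.scale /= mulr1.
  by [].
have d1E s : derive1 x s = lim (q h s @[h --> 0^']).
  by [].
pose E (n m : nat) : set R := \bigcap_(h in [set h : R * R |
    [/\ h.1 != 0, h.2 != 0, `|h.1| < m.+1%:R^-1 & `|h.2| < m.+1%:R^-1]])
  [set s | `|q h.1 s - q h.2 s| <= n.+1%:R^-1].
have mE n m : measurable (E n m).
  apply: closed_measurable; apply: closed_bigI => h _.
  apply: (@preimage_closed _ _ (fun s => `|q h.1 s - q h.2 s|) [set r : R | r <= n.+1%:R^-1]).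
    by move=> s _; apply: cvg_norm; apply: cvgB; exact: cq.
  exact: closed_le.
(* Cauchy criterion for the difference quotients as the increment tends to 0. *)
have DE : [set s | derivable x s 1] = \bigcap_n \bigcup_m E n m.
  apply/seteqP; split => s /=.
  - rewrite dE => cv n _.
    have n2 : 0 < n.+1%:R^-1 / 2 :> R by rewrite divr_gt0 ?invr_gt0.
    have /cvgrPdist_lt /(_ _ n2) /nbhs_ballP[d /= d0 dP] := cv.
    have [m _ /(_ m (leqnn m)) md] := near_infty_natSinv_lt (PosNum d0).
    exists m => //= -[h h'] /= [h0 h'0 hm h'm].
    have qd r : r != 0 -> `|r| < m.+1%:R^-1 -> `|lim (q h s @[h --> 0^']) - q r s| < n.+1%:R^-1 / 2.
      move=> r0 rm; apply: dP => //.
      by rewrite /ball /= sub0r normrN (lt_trans rm).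
    apply: le_trans (ler_distD (lim (q h s @[h --> 0^'])) (q h s) (q h' s)) _.
    by rewrite [X in X + _]distrC (splitr (n.+1%:R^-1)) ltW// ltrD// qd.
  - move=> sE; rewrite dE; apply/cauchy_cvgP/cauchyP => e e0.
    have [n _ /(_ n (leqnn n)) ne] := near_infty_natSinv_lt (PosNum e0).
    have [m _ mP] := sE n I.
    have m20 : 0 < m.+2%:R^-1 :> R by rewrite invr_gt0.
    exists (q m.+2%:R^-1 s).
    have m10 : 0 < m.+1%:R^-1 :> R by rewrite invr_gt0.
    apply/nbhs_ballP; exists m.+1%:R^-1 => //= h; rewrite /ball /= sub0r normrN => hm h0.
    apply: le_lt_trans ne; apply: (mP (m.+2%:R^-1, h)); split => //=.
    by rewrite ger0_norm ?ltW// ltf_pV2 ?posrE// ltr_nat.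
have mD : measurable [set s | derivable x s 1].
  by rewrite DE; apply: bigcapT_measurable => n; apply: bigcupT_measurable => m; exact: mE.
rewrite (_ : [set: R] = [set s | derivable x s 1] `|` ~` [set s | derivable x s 1]); last first.
  by rewrite setUCr.
apply/measurable_funU => //; first exact: measurableC.
split.
- apply: (@measurable_fun_cvg _ _ _ _ (fun n : nat => q n.+1%:R^-1)).
    by move=> n; apply: measurable_funTS; exact: continuous_measurable_fun.
  move=> s /=; rewrite dE d1E => cv.
  apply/cvgrPdist_lt => e e0.
  have /cvgrPdist_lt /(_ _ e0) /nbhs_ballP[d /= d0 dP] := cv.
  have := near_infty_natSinv_lt (PosNum d0); apply: filterS => n /= nd.
  have n0 : 0 < n.+1%:R^-1 :> R by rewrite invr_gt0.
  by apply: dP; [rewrite /ball /= sub0r normrN ger0_norm ?ltW|rewrite gt_eqF].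
(* Where there is no derivative, derive1 takes the default value of limits. *)
- apply: (eq_measurable_fun (cst (point : R))) => //.
  by move=> s; rewrite inE /= dE d1E => ncv; rewrite dvgP.
Qed.

End derivative_measurable.

Section solution.
Context {R : realType}.
Local Notation mu := (@lebesgue_measure R).

Lemma Gamma1 : Gamma 1 = 1 :> R.
Proof.
have /(congr1 fine) /= -> := @GammaE R 1 ltr01 (lexx 1).
rewrite -[RHS]invr1 -[RHS]/(fine (1^-1)%:E) -laplace_heaviside//; congr fine.
by apply: eq_integral => u _; rewrite /pkern subrr powRr0 mulr1.
Qed.

Lemma fkern1 : fkern 1 = heaviside :> (R -> R).
Proof.
by apply/funext => t; rewrite /fkern Gamma1 invr1 mul1r /pkern subrr powRr0 mulr1.
Qed.

Lemma conv_heavisideE (G : R -> R) (t : R) : continuous G ->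
  conv heaviside (fun s => heaviside s * G s) t = \int[mu]_(s in `[0, t]) G s.
Proof.
move=> cG; have Gi : mu.-integrable `[0, t] (EFin \o G).
  by apply: continuous_compact_integrable; [exact: segment_compact|exact: continuous_subspaceT].
have Gi1 : mu.-integrable `]0, t] (EFin \o G).
  by apply: integrableS Gi => //; exact: subset_itv_oc_cc.
have Gi2 : mu.-integrable `]0, t[ (EFin \o G).
  by apply: integrableS Gi => //; exact: subset_itv_oo_cc.
rewrite -Rintegral_itv_obnd_cbnd// -Rintegral_itv_bndo_bndc//.
rewrite [RHS]Rintegral_mkcond; apply: eq_Rintegral => s _.
rewrite patchE !heavisideE subr_gt0.
have -> : (s \in `]0, t[%classic) = (0 < s) && (s < t).
  by apply/idP/idP; rewrite inE /= in_itv.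
by case: (0 < s); case: (s < t); rewrite ?mul1r ?mul0r ?mulr0.
Qed.

Variables (al tau T T' x0 F0 : R) (f : R -> R -> R) (z h : R -> R).
Hypotheses (al_gt0 : 0 < al) (al_le1 : al <= 1) (TT : T' <= T).
Hypotheses (zi : mu.-integrable setT (EFin \o z)) (hi : mu.-integrable setT (EFin \o h)).
Hypotheses (z_le0 : forall s, s <= 0 -> z s = 0) (h_le0 : forall s, s <= 0 -> h s = 0).
Hypothesis zE : {ae mu, forall s, 0 < s < T -> z s = F0 * fkern al s + conv (fkern al) h s}.
Local Notation x := (state x0 z).
Hypothesis fE : forall t, 0 < t -> t < T' -> F0 + primitive h t = f (x t) (x (t - tau)).

Lemma state_continuous : continuous x.
Proof.
by move=> t; apply: cvgD; [exact: cvg_cst|exact: primitive_continuous].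
Qed.

Lemma state_history t : t <= 0 -> x t = x0.
Proof.
by move=> t0; rewrite /state /primitive conv_le0 ?addr0//; exact: heaviside_le0.
Qed.

Lemma state_derivable : {ae mu, forall t, derivable x t 1 /\ derive1 x t = z t}.
Proof.
apply: ae_imp (primitive_FTC zi) => t [dt zt].
have -> : x = cst x0 + primitive z by [].
have dc := @derivable_cst R R R x0 t 1.
split; first exact: derivableD.
by rewrite derive1E deriveD// derive_cst add0r -derive1E.
Qed.

Lemma state_abs_continuous t : abs_continuous 0 t x.
Proof.
have md := measurable_derive1 state_continuous.
have mz := integrable_measurable zi.
have di : mu.-integrable setT (EFin \o derive1 x).
  apply: ae_eq_integrable zi => //.
  by apply: ae_imp state_derivable => s [_ ->].
split.
- by apply: ae_imp state_derivable => s [].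
- exact: integrableS di.
- move=> s; rewrite in_itv /= => /andP[s0 _].
  rewrite (state_history (lexx 0)) /state; congr (_ + _); rewrite primitiveE//.
  rewrite (@ae_eq_Rintegral _ _ (derive1 x) z)//; first last.
  + by apply: ae_imp state_derivable => r [_ ->].
  + exact: measurable_funTS.
  + exact: measurable_funTS.
  rewrite Rintegral_mkcond [RHS]Rintegral_mkcond; apply: eq_Rintegral => r _.
  rewrite !patchE; have [r0|r0] := leP r 0; first by rewrite z_le0// !if_same.
  congr (if _ then _ else _); apply/idP/idP; rewrite !inE /= !in_itv /= => //.
    by move=> ->; rewrite ltW.
  by case/andP.
Qed.

(** The derivative of the state is z almost everywhere, so its fractional integral of
    order 1 - alpha is the convolution already computed. *)
Lemma state_caputo t : 0 < t -> t < T' ->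
  caputo_derivable al x t /\ caputo al x t = f (x t) (x (t - tau)).
Proof.
move=> t0 tT'; have tT : t < T by exact: lt_le_trans TT.
have md := measurable_derive1 state_continuous.
have mz := integrable_measurable zi.
rewrite /caputo_derivable /caputo -fE//; case: eqP => [al1|/eqP al1].
(* For alpha = 1 the kernel is constant and the equation is integrated once. *)
- pose G s := F0 + primitive h s; pose F s := \int[mu]_(r in `[0, s]) G r.
  have cG : continuous G.
    by move=> s; apply: cvgD; [exact: cvg_cst|exact: primitive_continuous].
  have xE s : s < T -> x s = (cst x0 + F) s.
    move=> sT; rewrite /state (volterra_state al_gt0 al_le1 zi hi z_le0 h_le0 zE sT).
    by rewrite al1 fkern1 conv_heavisideE.
  have [dF dFE] : derivable F t 1 /\ F^`() t = G t.
    apply: (@continuous_FTC1_closed _ G 0 t T) => //; last exact: cG.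
    by apply: continuous_compact_integrable; [exact: segment_compact|exact: continuous_subspaceT].
  have nE : {near t, (cst x0 + F) =1 x}.
    near=> s; rewrite xE//; near: s; exact: lt_nbhsl.
  have dc := @derivable_cst R R R x0 t 1.
  split; first by apply: near_eq_derivable nE _; exact: derivableD.
  rewrite derive1E -(near_eq_derive _ nE) deriveD// derive_cst add0r -derive1E.
  exact: dFE.
- have {}al1 : al < 1 by rewrite lt_neqAle al1.
  have al'0 : 0 < 1 - al by rewrite subr_gt0.
  have G0 : Gamma (1 - al) != 0 by rewrite gt_eqF// Gamma_gt0// gerBl ltW.
  have [fzi fzE] := volterra_caputo al_gt0 al_le1 zi hi z_le0 h_le0 zE al1 t0 tT.
  pose D : set R := `[0, t]%classic.
  have mD : measurable D by exact: measurable_itv.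
  have mf : measurable_fun D (fun s => (t - s) `^ (- al) * derive1 x s).
    apply: measurable_funTS; apply: measurable_funM => //.
    by apply: (measurableT_comp (@measurable_powR R (- al))); exact: measurable_funB.
  have gi : mu.-integrable D (EFin \o (fun s => Gamma (1 - al) * (fkern (1 - al) (t - s) * z s))).
    have gT : mu.-integrable setT
        (EFin \o (fun s => Gamma (1 - al) * (fkern (1 - al) (t - s) * z s))).
      have := integrableZl measurableT (Gamma (1 - al)) fzi.
      by apply: eq_integrable => // s _; rewrite /= -EFinM.
    exact: integrableS gT.
  have ae : {ae mu, forall s, D s -> (t - s) `^ (- al) * derive1 x s =
      Gamma (1 - al) * (fkern (1 - al) (t - s) * z s)}.
    apply: ae_imp2 (ae_neq t) state_derivable => s st [_ ->].
    rewrite /D /= in_itv /= => /andP[_ st'].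
    rewrite /fkern /pkern heavisideE subr_gt0 lt_neqAle st st' mul1r.
    rewrite mulrA mulrA mulfV// mul1r; congr (_ `^ _ * _); ring.
  split; first split.
  + exact: state_abs_continuous.
  + exact: ae_eq_integrable gi.
  + rewrite (ae_eq_Rintegral _ _ _ ae)//; last first.
      by apply/measurable_EFinP; case/integrableP : gi.
    rewrite RintegralZl//; last exact: integrableS fzi.
    rewrite mulrA mulVf// mul1r -fzE.
    rewrite /conv Rintegral_mkcond; apply: eq_Rintegral => s _.
    rewrite patchE; case: ifPn => //; rewrite notin_setE /D /= => sD.
    have [s0|s0] := leP s 0; first by rewrite z_le0// mulr0.
    rewrite fkern_le0 ?mul0r// subr_le0 leNgt; apply/negP => st.
    by apply: sD; rewrite /= in_itv /= !ltW.
Unshelve. all: by end_near. Qed.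

Lemma state_is_solution : is_solution al tau f (cst x0) T' x.
Proof.
split.
- apply: continuous_subspaceT; exact: state_continuous.
- by move=> t; rewrite in_itv /= => /andP[_ t0]; exact: state_history.
- by move=> t; rewrite in_itv /= => /andP[t0 tT]; exact: state_caputo.
Qed.

End solution.

(** * Characteristic roots *)

Section scalar_bounds.
Context {R : realType}.
Implicit Types (al tau a b lam : R).

(** Intermediate value theorem for the characteristic equation of the linearization:
    at 0 the right side is a + b > 0, and the left side is unbounded. *)
Lemma char_root al tau a b : 0 < al -> 0 <= tau -> 0 < a + b ->
  exists2 lam, 0 < lam & lam `^ al = a + b * expR (- lam * tau).
Proof.
move=> al0 tau0 ab0; pose v := (a + b) / 4; have v0 : 0 < v by rewrite divr_gt0.
pose K := `|b| * tau + 1; have K0 : 0 < K by rewrite ltr_wpDl// mulr_ge0.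
(* At l0 the left side is at most (a + b) / 4 and the delay costs at most as
   much, while at l1 the left side is |a| + |b|. *)
pose l0 := Num.min (v `^ al^-1) (v / K).
have l00 : 0 < l0 by rewrite lt_min powR_gt0// divr_gt0.
pose M := `|a| + `|b|.
have vM : v <= M.
  rewrite /v /M; have := ler_norm a; have := ler_norm b; move: ab0; lra.
pose l1 := M `^ al^-1.
have al'0 : 0 <= al^-1 by rewrite invr_ge0 ltW.
have M0 : 0 <= M by rewrite addr_ge0.
have l01 : l0 <= l1.
  by rewrite ge_min ge0_ler_powR// nnegrE ltW.
have inv r : 0 <= r -> (r `^ al^-1) `^ al = r.
  by move=> r0; rewrite -powRrM mulVf ?gt_eqF// powRr1.
pose f lam := lam `^ al - (a + b * expR (- lam * tau)).
have f0 : f l0 <= 0.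
  have h1 : l0 `^ al <= v.
    rewrite -[leRHS](inv v (ltW v0)); apply: ge0_ler_powR; rewrite ?nnegrE ?powR_ge0 ?(ltW l00) ?(ltW al0)//.
    by rewrite ge_min lexx.
  have h2 : `|b| * (l0 * tau) <= v.
    have : l0 * K <= v by rewrite -ler_pdivlMr// ge_min lexx orbT.
    rewrite /K; have := ltW l00; lra.
  have h3 : `|b * (1 - expR (- l0 * tau))| <= `|b| * (l0 * tau).
    rewrite normrM ler_wpM2l// ger0_norm.
      by have := expR_ge1Dx (- l0 * tau); lra.
    by rewrite subr_ge0 -expR0 ler_expR mulNr oppr_le0 mulr_ge0// ltW.
  have := ler_norm (b * (1 - expR (- l0 * tau))).
  rewrite /f; move: h1 h2 h3 ab0; rewrite /v; lra.
have f1 : 0 <= f l1.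
  rewrite /f inv// subr_ge0 /M lerD ?ler_norm//.
  apply: le_trans (ler_norm _) _; rewrite normrM ler_piMr// ger0_norm ?expR_ge0//.
  by rewrite -expR0 ler_expR mulNr oppr_le0 mulr_ge0// powR_ge0.
have fc : {within `[l0, l1], continuous f}.
  apply: continuous_in_subspaceT => x; rewrite inE /= in_itv /= => /andP[x0 _].
  apply: cvgB; first by apply: powR_continuous_at; exact: lt_le_trans x0.
  apply: cvgD; first exact: cvg_cst.
  apply: cvgM; first exact: cvg_cst.
  apply: (@continuous_comp _ _ _ (fun u : R => - u * tau) expR); last exact: continuous_expR.
  apply: cvgM; last exact: cvg_cst.
  by apply: cvgN; exact: cvg_id.
have [lam] := @IVT R f l0 l1 0 l01 fc ltac:(by rewrite ge_min le_max f0 f1 orbT).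
rewrite in_itv /= => /andP[l0lam _] /eqP; rewrite subr_eq0 => /eqP lamE.
by exists lam => //; exact: lt_le_trans l0lam.
Qed.

Lemma exp_small (l K m : R) : 0 < l -> 0 <= K -> 0 < m ->
  exists2 T : R, 0 < T & expR (- (l * T)) * K < m.
Proof.
move=> l0 K0 m0; pose X := K / m + 2.
have X0 : 0 < X by rewrite ltr_wpDl// divr_ge0// ltW.
exists (ln X / l); first by rewrite divr_gt0// ln_gt0// ltr_wpDl ?ltr1n// divr_ge0// ltW.
have -> : l * (ln X / l) = ln X by rewrite mulrCA mulfV ?mulr1// gt_eqF.
rewrite expRN lnK ?posrE// mulrC ltr_pdivrMr// /X mulrDr.
by rewrite mulrCA mulfV ?gt_eqF// mulr1 ltrDl mulr_gt0.
Qed.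

End scalar_bounds.

(** * First exit *)

Section first_exit.
Context {R : realType}.

(** Continuation argument: a continuous y that is bounded by r < eta as long as it
    stays below eta never reaches eta. *)
Lemma bootstrap (y : R -> R) (r eta T : R) : continuous y -> r < eta -> 0 < T ->
  (forall t, t <= 0 -> `|y t| <= r) -> (forall t, T <= t -> y t = y T) ->
  (forall S, 0 < S -> S <= T -> (forall t, t < S -> `|y t| < eta) ->
     forall t, 0 <= t -> t < S -> `|y t| <= r) ->
  forall t, `|y t| < eta.
Proof.
move=> cy reta T0 y0 yT H t; rewrite ltNge; apply/negP => teta.
pose E : set R := [set s | eta <= `|y s|].
have E0 s : E s -> 0 <= s.
  rewrite /E /= => es; rewrite leNgt; apply/negP => s0.
  by have := y0 s (ltW s0); rewrite leNgt (lt_le_trans reta es).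
have hE : has_inf E by split; [exists t|exists 0 => s /E0].
pose s := inf E.
have before u : u < s -> `|y u| < eta.
  move=> us; rewrite ltNge; apply/negP => Eu; have := ge_inf hE.2 Eu.
  by rewrite leNgt us.
have ys : `|y s| <= r.
  have [s0|s0] := leP s 0; first exact: y0.
  (* The hypothesis is only available up to time T; y is constant afterwards. *)
  pose S := Num.min s T.
  have S0 : 0 < S by rewrite lt_min s0.
  have ST : S <= T by rewrite ge_min lexx orbT.
  have -> : y s = y S.
    by rewrite /S; have [//|Ts] := leP s T; exact/yT/ltW.
  have Ss : S <= s by rewrite ge_min lexx.
  have yS := H S S0 ST (fun u uS => before u (lt_le_trans uS Ss)).
  apply: (@cvgr_to_le _ (S^'-) _ _ (fun u => `|y u|)).
    by apply: cvg_at_left_filter; apply: cvg_norm; exact: cy.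
  near=> u; apply: yS; last by near: u; exact: nbhs_left_lt.
  by near: u; exact: nbhs_left_ge.
have : \forall u \near s, `|y u| < eta.
  have /cvgr_lt : `|y u| @[u --> s] --> `|y s| by apply: cvg_norm; exact: cy.
  by apply; exact: le_lt_trans reta.
case/nbhs_ballP => d /= d0 dP.
have [u Eu] := inf_adherent d0 hE; rewrite -/s => usd.
have su : s <= u by exact: ge_inf hE.2 _ Eu.
have : `|y u| < eta.
  by apply: dP; rewrite /ball /= distrC ger0_norm ?subr_ge0// ltrBlDl.
by rewrite ltNge Eu.
Unshelve. all: by end_near. Qed.

Lemma state_after (x0 T : R) (z : R -> R) t : (forall s, ~ `]0, T[%classic s -> z s = 0) ->
  T <= t -> state x0 z t = state x0 z T.
Proof.
move=> z0 Tt; rewrite /state; congr (_ + _); apply: eq_Rintegral => s _.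
have [Ts|sT] := leP T s.
  by rewrite z0 ?mulr0// /= in_itv /= [s < T]ltNge Ts andbF.
by rewrite !heavisideE !subr_gt0 sT (lt_le_trans sT Tt).
Qed.

End first_exit.

(** * The equilibrium *)

Section equilibrium.
Context {R : realType}.
Local Notation mu := (@lebesgue_measure R).

Lemma equilibrium_zero (al tau xs : R) (f : R -> R -> R) :
  f xs xs = 0 -> equilibrium al tau f xs.
Proof.
move=> f0 T T0; split => //; first by apply: continuous_subspaceT => t; exact: cvg_cst.
move=> t _; rewrite /caputo_derivable /caputo /cst.
have d0 (s : R) : derive1 (fun=> xs) s = 0 by rewrite derive1_cst.
have i0 (D : set R) : measurable D -> mu.-integrable D (EFin \o (fun=> 0 : R)).
  by move=> mD; exact: integrable0.
rewrite f0; case: eqP => _; first by split; [exact: derivable_cst|exact: d0].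
split; last first.
  rewrite (_ : (fun s : R => (t - s) `^ (- al) * derive1 (fun=> xs) s) = cst 0).
    by rewrite Rintegral_cst//= ?mul0r ?mulr0.
  by apply/funext => s; rewrite d0 mulr0.
split; first split.
- by apply: aeW => s _; exact: derivable_cst.
- by apply: eq_integrable (i0 _ (measurable_itv _)) => // s _; rewrite /= d0.
- move=> s _; rewrite (_ : derive1 (fun=> xs) = cst 0); last exact/funext.
  by rewrite Rintegral_cst//= mul0r addr0.
- by apply: eq_integrable (i0 _ (measurable_itv _)) => // s _; rewrite /= d0 mulr0.
Qed.

Variables (delta eps p q : R).
Local Notation xs := (x2star delta eps p q).
Local Notation D := (p ^+ 2 + 4 * eps * (delta + q)).

Lemma x2star_root : eps != 0 -> 0 <= D -> eps * xs ^+ 2 + p * xs = delta + q.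
Proof.
move=> e0 D0; have sD := sqr_sqrtr D0; rewrite /x2star.
set s := Num.sqrt D in sD *.
have -> : eps * ((- p + s) / (2 * eps)) ^+ 2 + p * ((- p + s) / (2 * eps)) =
  (s ^+ 2 - p ^+ 2) / (4 * eps) by field.
by rewrite sD; field.
Qed.

Lemma rhs_x2star (u v : R) : eps != 0 -> 0 <= D ->
  rhs delta eps p q (xs + u) (xs + v) =
  cubic_field (q - 2 * p * xs) (delta - 3 * eps * xs ^+ 2) p (- (3 * eps * xs)) (- eps) u v.
Proof.
move=> e0 D0; have := x2star_root e0 D0.
(* The equilibrium equation eliminates delta, and the rest is a polynomial
   identity. *)
move: (xs) => x xE; rewrite /rhs /cubic_field.
have E : delta = eps * x ^+ 2 + p * x - q by rewrite xE addrK.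
by rewrite E; ring.
Qed.

(** The sum of the two linear coefficients is what decides: it is positive, so the
    characteristic equation has a positive root for every delay. *)
Lemma x2star_linear_part : eps != 0 -> 0 <= D ->
  (q - 2 * p * xs) + (delta - 3 * eps * xs ^+ 2) = - xs * Num.sqrt D.
Proof.
move=> e0 D0; have := x2star_root e0 D0.
have -> : Num.sqrt D = p + 2 * eps * xs by rewrite /x2star; field.
move: (xs) => x xE.
have E : delta = eps * x ^+ 2 + p * x - q by rewrite xE addrK.
by rewrite E; ring.
Qed.

Lemma discriminant_gt : eps < 0 -> q + delta < 0 -> p ^+ 2 < D.
Proof.
by move=> e0 qd; rewrite ltrDl -mulrA pmulr_rgt0// nmulr_rgt0// addrC.
Qed.

Lemma x2star_lt0 : eps < 0 -> 0 < p -> q + delta < 0 -> xs < 0.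
Proof.
move=> e0 p0 qd; have pD := discriminant_gt e0 qd.
have D0 : 0 < D by apply: le_lt_trans pD; exact: sqr_ge0.
have : p < Num.sqrt D by rewrite -[ltLHS]ger0_norm ?ltW// -sqrtr_sqr ltr_sqrt.
by move=> ps; rewrite /x2star ltr_ndivrMr ?mul0r ?pmulr_rlt0// addrC subr_gt0.
Qed.

End equilibrium.

(** * Instability *)

Section escape.
Context {R : realType}.
Variables (al tau a b p c2 e eta : R).
Hypotheses (al_gt0 : 0 < al) (al_le1 : al <= 1) (tau_ge0 : 0 <= tau).
Hypotheses (ab_gt0 : 0 < a + b) (eta_gt0 : 0 < eta).
Local Notation g := (cubic_field a b p c2 e).
Hypothesis g_le : forall u v, `|v| <= eta -> g u v <= a * u + b * v.

Lemma cubic_field_bound (u v : R) : `|u| <= eta -> `|v| <= eta ->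
  `|g u v| <= `|a| * eta + `|b| * eta + `|p| * eta ^+ 2 + `|c2| * eta ^+ 2 + `|e| * eta ^+ 3.
Proof.
move=> ue ve; have eta0 := ltW eta_gt0.
have pw (n : nat) (c w : R) : `|w| <= eta -> `|c * w ^+ n| <= `|c| * eta ^+ n.
  by move=> we; rewrite normrM ler_wpM2l// normrX lerXn2r// nnegrE.
rewrite /cubic_field; do 2 (apply: le_trans (ler_normD _ _) _; apply: lerD; last exact: pw).
apply: le_trans (ler_normB _ _) _; apply: lerD; last exact: pw.
apply: le_trans (ler_normD _ _) _; apply: lerD; [exact: (pw 1%N)|exact: (pw 1%N)].
Qed.

Lemma measurable_cubic (u v : R -> R) :
  measurable_fun [set: R] u -> measurable_fun [set: R] v ->
  measurable_fun [set: R] (fun t => g (u t) (v t) - a * u t - b * v t).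
Proof.
move=> mu' mv; have mZ (k : R) (w : R -> R) : measurable_fun [set: R] w ->
    measurable_fun [set: R] (fun t => k * w t) by move=> mw; exact: measurable_funM.
have mX (n : nat) (k : R) (w : R -> R) : measurable_fun [set: R] w ->
    measurable_fun [set: R] (fun t => k * w t ^+ n).
  by move=> mw; apply: mZ; exact: measurable_funX.
rewrite /cubic_field.
by apply: measurable_funB (mZ b _ mv); apply: measurable_funB (mZ a _ mu');
  apply: measurable_funD (mX 3%N e _ mv); apply: measurable_funD (mX 2%N c2 _ mv);
  apply: measurable_funB (mX 2%N p _ mu'); exact: measurable_funD (mZ a _ mu') (mZ b _ mv).
Qed.

(** The horizon T is chosen from c alone, before the trajectory, so that the
    trajectory can then be constructed on ]0, T[. *)
Lemma trajectory_escapes (c : R) : 0 < c -> exists2 T : R, 0 < T &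
  forall z h : R -> R,
  lebesgue_measure.-integrable setT (EFin \o z) ->
  lebesgue_measure.-integrable setT (EFin \o h) ->
  (forall t, t <= 0 -> z t = 0) -> (forall t, t <= 0 -> h t = 0) ->
  {ae lebesgue_measure, forall s, 0 < s < T ->
     z s = g (- c) (- c) * fkern al s + conv (fkern al) h s} ->
  (forall t, g (- c) (- c) + primitive h t = g (state (- c) z t) (state (- c) z (t - tau))) ->
  ~ (forall t, `|state (- c) z t| <= eta).
Proof.
move=> c0; have [lam lam0 lamE] := char_root al_gt0 tau_ge0 ab_gt0.
pose Cg := `|a| * eta + `|b| * eta + `|p| * eta ^+ 2 + `|c2| * eta ^+ 2 + `|e| * eta ^+ 3.
have eta0 := ltW eta_gt0.
have Cg0 : 0 <= Cg by rewrite !addr_ge0// mulr_ge0// exprn_ge0.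
have l2 : 0 < lam / 2 by rewrite divr_gt0.
have K0 : 0 <= tail_const al lam c eta Cg.
  have l2i : 0 <= (lam / 2)^-1 by rewrite invr_ge0 ltW.
  by rewrite addr_ge0// !mulr_ge0// ?powR_ge0// addr_ge0// ltW.
have m0 : 0 < lam `^ (- al) * (c * (a + b)) / lam.
  by rewrite divr_gt0// mulr_gt0 ?powR_gt0// mulr_gt0.
(* The bound given by the Laplace transform fails beyond this time. *)
have [T T0 TP] := exp_small l2 K0 m0.
exists T => // z h zi hi z_le0 h_le0 zE hE yeta.
have cy := @state_continuous R (- c) z zi.
have cys : continuous (fun t => state (- c) z (t - tau)).
  move=> t; apply: (@continuous_comp _ _ _ (fun t => t - tau) (state (- c) z)); last exact: cy.
  by apply: cvgB; [exact: cvg_id|exact: cvg_cst].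
have my := continuous_measurable_fun cy; have mys := continuous_measurable_fun cys.
pose N t := g (state (- c) z t) (state (- c) z (t - tau)) - a * state (- c) z t
  - b * state (- c) z (t - tau).
have ZE t : primitive z t - c = state (- c) z t by rewrite /state addrC.
have GE t : a * (primitive z t - c) + b * (primitive z (t - tau) - c) + N t =
    g (state (- c) z t) (state (- c) z (t - tau)).
  by rewrite !ZE /N; ring.
have := @laplace_bound R al lam tau a b c eta Cg al_gt0 al_le1 lam0 tau_ge0 (ltW c0) lamE
  T (primitive z) N (ltW T0).
move=> /(_ _ _ _ _ _ _ _) H.
suff : lam `^ (- al) * (c * (a + b)) / lam <=
    expR (- (lam / 2 * T)) * tail_const al lam c eta Cg by rewrite leNgt TP.
apply: H.
- apply: continuous_measurable_fun; exact: primitive_continuous.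
- exact: (measurable_cubic my mys).
- by move=> t t0; apply: conv_le0 => //; exact: heaviside_le0.
- by move=> t; rewrite ZE.
- move=> t; rewrite /N -addrA -opprD subr_le0; exact: g_le.
- by move=> t; rewrite GE; exact: cubic_field_bound.
- move=> t tT; rewrite (volterra_state al_gt0 al_le1 zi hi z_le0 h_le0 zE tT).
  by apply: eq_Rintegral => s _; rewrite GE hE.
Qed.

(** If the equilibrium were stable, the trajectory from a small constant history
    below it would be a solution confined to |y| < eta, which the Laplace transform
    forbids. *)
Lemma unstable_cubic (xs : R) (f : R -> R -> R) :
  (forall u v, f (xs + u) (xs + v) = g u v) -> unstable al tau f xs.
Proof.
move=> fg st; have eta2 : 0 < eta / 2 by rewrite divr_gt0.
have [rho rho0 H] := st _ eta2.
(* The history is the constant - c. *)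
pose c := Num.min (rho / 2) (eta / 2).
have c0 : 0 < c by rewrite lt_min eta2 divr_gt0.
have crho : c < rho by rewrite gt_min ltr_pdivrMr// ltr_pMr// ltr1n.
have ceta : c <= eta / 2 by rewrite ge_min lexx orbT.
have eta2lt : eta / 2 < eta by rewrite ltr_pdivrMr// ltr_pMr// ltr1n.
have [T T0 TP] := trajectory_escapes c0.
have [z [h [zi z0 hi h_le0 [zE hE]]]] :=
  trajectory_exists T (- c) a b p c2 e al_gt0 al_le1 tau_ge0 (ltW eta_gt0).
have z_le0 s : s <= 0 -> z s = 0.
  by move=> s0; apply: z0; rewrite /= in_itv /= ltNge s0.
have cy := @state_continuous R (- c) z zi.
have shiftE t : state (xs - c) z t = xs + state (- c) z t by rewrite /state addrA.
have hist : history_norm tau (fun t => cst (xs - c) t - xs) < rho.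
  rewrite /history_norm (_ : [set _ | _ in _] = [set c]) ?sup1//.
  apply/seteqP; split => [_ [t _ <-]|_ ->] /=.
    by rewrite addrC addKr normrN gtr0_norm.
  by exists 0; rewrite /= ?in_itv /= ?oppr_le0 ?tau_ge0 ?lexx// addrC addKr normrN gtr0_norm.
(* As long as |y| < eta the clipped trajectory is a genuine solution, and
   stability then keeps it below eta / 2. *)
have ylt : forall t, `|state (- c) z t| < eta.
  apply: (bootstrap (T := T) cy eta2lt T0).
  - by move=> t t0; rewrite (state_history _ z_le0 t0) normrN gtr0_norm.
  - by move=> t; exact: state_after.
  - move=> S S0 ST yS t t0 tS; apply/ltW.
    have := H (cst (xs - c)) _ hist S (state (xs - c) z) S0 _ t.
    have -> : state (xs - c) z t - xs = state (- c) z t by rewrite shiftE addrAC subrr add0r.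
    apply; last by rewrite in_itv /= t0.
      by apply: continuous_subspaceT => s; exact: cvg_cst.
    apply: (state_is_solution al_gt0 al_le1 ST zi hi z_le0 h_le0 zE) => s s0 sS.
    rewrite !shiftE fg; apply: hE => r rs; apply/ltW/yS; exact: le_lt_trans sS.
apply: (TP z h) => // [t|t]; last exact/ltW.
by apply: hE => r _; exact/ltW.
Qed.

End escape.

Theorem theorem8 (R : realType) (alpha delta eps p q : R)
  (alpha_gt0 : 0 < alpha) (alpha_le1 : alpha <= 1)
  (eps_lt0 : eps < 0) (p_gt0 : 0 < p) (qdelta_lt0 : q + delta < 0) :
  forall tau : R, 0 <= tau ->
    equilibrium alpha tau (rhs delta eps p q) (x2star delta eps p q) /\
    unstable alpha tau (rhs delta eps p q) (x2star delta eps p q).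
Proof.
move=> tau tau0; have e0 : eps != 0 by rewrite lt_eqF.
have pD := discriminant_gt p eps_lt0 qdelta_lt0.
have D0 : 0 < p ^+ 2 + 4 * eps * (delta + q) by apply: le_lt_trans pD; exact: sqr_ge0.
have xs0 := x2star_lt0 eps_lt0 p_gt0 qdelta_lt0.
have rE := rhs_x2star _ _ e0 (ltW D0).
split.
  apply: equilibrium_zero; have := rE 0 0; rewrite addr0 => ->.
  by rewrite /cubic_field; ring.
apply: (@unstable_cubic R alpha tau _ _ p _ _ (- x2star delta eps p q) _ _ _ _ _ _ _ _ rE) => //.
- by rewrite x2star_linear_part// ?ltW// mulr_gt0 ?oppr_gt0 ?sqrtr_gt0.
- by rewrite oppr_gt0.
- move: (x2star delta eps p q) xs0 => xs xs0 u v; rewrite ler_norml opprK => /andP[v1 v2].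
  rewrite /cubic_field -subr_le0.
  set A := q - _; set B := delta - _.
  have -> : A * u + B * v - p * u ^+ 2 + - (3 * eps * xs) * v ^+ 2 + - eps * v ^+ 3 - (A * u + B * v)
    = - (p * u ^+ 2) + eps * (- (3 * xs) - v) * v ^+ 2 by ring.
  have h1 : 0 <= p * u ^+ 2 by rewrite mulr_ge0 ?sqr_ge0// ltW.
  have h2 : eps * (- (3 * xs) - v) * v ^+ 2 <= 0.
    by rewrite mulr_le0_ge0 ?sqr_ge0// mulr_le0_ge0 ?ltW//; lra.
  lra.
Qed.
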